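(* Let $k$ be a field, $X$ a smooth projective $k$-scheme and $G$ a finite group acting on $X$, with $\mathrm{char}(k)\nmid \mathrm{ord}(G)$. Suppose there is an object $\mathcal{T}^{\bullet}\in D_G(\mathrm{Qcoh}(X))$ which, considered as an object of $D(\mathrm{Qcoh}(X))$ (by forgetting the equivariant structure), is a tilting object on $X$. Let $k[G]$ denote the regular representation of $G$. Then $\mathcal{T}^{\bullet}\otimes k[G]$ is a tilting object on $[X/G]$.
   Context: A $G$-linearization (equivariant structure) on a sheaf $\mathcal{F}$ on $X$ is a family of isomorphisms $\lambda_g\colon \mathcal{F}\to g^*\mathcal{F}$, $g\in G$, with $\lambda_1=\mathrm{id}$ and $\lambda_{gh}=h^*\lambda_g\circ\lambda_h$. For equivariant sheaves $(\mathcal{F},\lambda),(\mathcal{G},\mu)$, $G$ acts on $\mathrm{Hom}(\mathcal{F},\mathcal{G})$ by $g\cdot f=\mu_g^{-1}\circ g^*f\circ\lambda_g$, and $\mathrm{Hom}_G(\mathcal{F},\mathcal{G})=\mathrm{Hom}(\mathcal{F},\mathcal{G})^G$. With these morphisms the equivariant quasi-coherent (resp. coherent) sheaves form abelian categories $\mathrm{Qcoh}_G(X)$ (resp. $\mathrm{Coh}_G(X)$), equivalent to the quasi-coherent (resp. coherent) sheaves on the quotient stack $[X/G]$. Put $D_G(\mathrm{Qcoh}(X))=D(\mathrm{Qcoh}_G(X))$, $D^b_G(X)=D^b(\mathrm{Coh}_G(X))$, and write $\mathrm{Hom}_G$ also for morphisms in $D_G(\mathrm{Qcoh}(X))$. An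 object $\mathcal{T}^{\bullet}\in D_G(\mathrm{Qcoh}(X))$ is a tilting object on $[X/G]$ if: (i) $\mathrm{Hom}_G(\mathcal{T}^{\bullet},\mathcal{T}^{\bullet}[i])=0$ for $i\neq 0$; (ii) if $\mathcal{N}^{\bullet}\in D_G(\mathrm{Qcoh}(X))$ satisfies $\mathbb{R}\mathrm{Hom}_G(\mathcal{T}^{\bullet},\mathcal{N}^{\bullet})=0$, then $\mathcal{N}^{\bullet}=0$; (iii) $\mathrm{Hom}_G(\mathcal{T}^{\bullet},-)$ commutes with direct sums. A tilting object on $X$ is the case $G=1$. For a representation $W$ of $G$ over $k$, $\mathcal{T}^{\bullet}\otimes W$ means the tensor product with $f^*W=\mathcal{O}_X\otimes_k W$ with its natural equivariant structure, where $f\colon X\to\mathrm{Spec}(k)$ is the structure morphism ($G$ acting trivially on $\mathrm{Spec}(k)$). *)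

(* Defs.v *)
From HB Require Import structures.
From mathcomp Require Import all_boot all_order all_algebra all_fingroup.
From mathcomp Require Import mxrepresentation.
From mathcomp Require Import -(notations) mpoly.
From mathcomp Require Import boolp classical_sets topology_structure.

Set Implicit Arguments.
Unset Strict Implicit.
Unset Printing Implicit Defensive.

Import GRing.Theory.
Local Open Scope classical_set_scope.
Local Open Scope ring_scope.

Record opens (T : topologicalType) := Opens {
  oset :> set T;
  osetP : open oset }.

Definition fullO (T : topologicalType) : opens T := Opens (@openT T).

Lemma subfull (T : topologicalType) (U : opens T) : U `<=` fullO T.
Proof. by []. Qed.

Lemma open_preim (S T : topologicalType) (f : S -> T) (cf : continuous f)
  (V : opens T) : open (f @^-1` V).
Proof. by apply: open_comp (osetP V) => x _; apply: cf. Qed.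

Definition preim (S T : topologicalType) (f : S -> T) (cf : continuous f)
  (V : opens T) : opens S := Opens (open_preim cf V).

(* The matching condition is stated on every open subset of V i `&` V j. *)
Definition sheaf_condition (T : topologicalType) (F : opens T -> Type)
    (res : forall U V : opens T, V `<=` U -> F U -> F V) : Prop :=
  forall (I : Type) (V : I -> opens T) (U : opens T)
    (VU : forall i, V i `<=` U), U `<=` \bigcup_i V i ->
  forall s : forall i, F (V i),
    (forall i j (W : opens T) (Wi : W `<=` V i) (Wj : W `<=` V j),
       res _ _ Wi (s i) = res _ _ Wj (s j)) ->
  exists! t : F U, forall i, res _ _ (VU i) t = s i.

(* Rings of sections may be trivial (e.g. over the empty set), hence
   comPzRingType. *)
Record ringedSpace := RingedSpace {
  space :> topologicalType;
  fn : opens space -> comPzRingType;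
  fres : forall U V : opens space, V `<=` U -> {rmorphism fn U -> fn V};
  fres_id : forall (U : opens space) (h : U `<=` U) a, fres h a = a;
  fres_comp : forall (U V W : opens space)
    (VU : V `<=` U) (WV : W `<=` V) (WU : W `<=` U) a,
    fres WV (fres VU a) = fres WU a;
  fn_sheaf : sheaf_condition (fun U V h => fres (U := U) (V := V) h) }.
Arguments fn {r} U.
Arguments fres {r U V} h.

(* The germ of a at x is a unit of the stalk at x. *)
Definition germ_unit (X : ringedSpace) (U : opens X) (a : fn U) (x : X) :=
  exists (V : opens X) (h : V `<=` U), oset V x /\ exists b, b * fres h a = 1.

Lemma open_nonvanishing (X : ringedSpace) (U : opens X) (a : fn U) :
  open [set x | germ_unit a x].
Proof.
rewrite openE => x [V [h [Vx ub]]]; apply: filterS (open_nbhs_nbhs _) => [y Vy|].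
  by exists V, h; split; first exact: Vy.
by split; [exact: osetP | exact: Vx].
Qed.

(* D(a), as an open subset of U. *)
Definition nonvanishing (X : ringedSpace) (U : opens X) (a : fn U) : opens X :=
  Opens (open_nonvanishing a).

Lemma nonvanishing_sub (X : ringedSpace) (U : opens X) (a : fn U) :
  nonvanishing a `<=` U.
Proof. by move=> x [V [h [Vx _]]]; apply: h. Qed.

Definition prime_ideal (A : comPzRingType) (P : set A) : Prop :=
  [/\ P 0, (forall a b, P a -> P b -> P (a + b)), (forall a b, P b -> P (a * b)),
      ~ P 1 & (forall a b, P (a * b) -> P a \/ P b)].

(* For phi : M -> N additive, with fM and fN the multiplications by f on M
   and N and phi compatible with them: phi identifies N with M[1/f]. *)
Definition is_localization (M N : zmodType) (fM : M -> M) (fN : N -> N)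
    (phi : M -> N) : Prop :=
  [/\ bijective fN,
      (forall y, exists x e, iter e fN y = phi x)
    & (forall x, phi x = 0 -> exists e, iter e fM x = 0)].

(* The canonical map U -> Spec O(U), sending x to the ideal of sections whose
   germ at x is not a unit, is an isomorphism of locally ringed spaces: it is
   well defined, bijective, a homeomorphism (the sets D(a) form a basis of the
   topology of U), and O(D(a)) = O(U)[1/a] for all a. *)
Definition affine (X : ringedSpace) (U : opens X) : Prop :=
  [/\ forall x, oset U x -> prime_ideal [set a : fn U | ~ germ_unit a x],
      forall P : set (fn U), prime_ideal P ->
        exists! x, oset U x /\ P = [set a : fn U | ~ germ_unit a x],
      forall (V : opens X), V `<=` U -> forall x, oset V x ->
        exists a : fn U, oset (nonvanishing a) x /\ nonvanishing a `<=` V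
    & forall a : fn U,
        is_localization ( *%R a) ( *%R (fres (@nonvanishing_sub X U a) a))
          (fres (@nonvanishing_sub X U a))].

(* A morphism X -> Spec k is the same as a ring morphism k -> O(X). *)
Record scheme (k : fieldType) := Scheme {
  rspace :> ringedSpace;
  locally_affine : forall x : rspace, exists U : opens rspace, oset U x /\ affine U;
  structural : {rmorphism k -> @fn rspace (fullO rspace)} }.

Definition scal (k : fieldType) (X : scheme k) (U : opens X) (c : k) : fn U :=
  fres (@subfull X U) (structural X c).

(* Morphisms of k-schemes, i.e. of locally ringed spaces over k. *)
Record smor (k : fieldType) (X Y : scheme k) := SMor {
  sfun :> X -> Y;
  scont : continuous sfun;
  comorph : forall V : opens Y, {rmorphism fn V -> fn (preim scont V)};
  comorph_res : forall (V W : opens Y) (h : W `<=` V)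
    (h' : preim scont W `<=` preim scont V) a,
    comorph W (fres h a) = fres h' (comorph V a);
  comorph_local : forall (V : opens Y) (a : fn V) (x : X),
    germ_unit (comorph V a) x -> germ_unit a (sfun x);
  comorph_scal : forall (V : opens Y) c, comorph V (scal V c) = scal _ c }.
Arguments scont {k X Y} s.
Arguments comorph {k X Y} s V.

Definition peval (k : fieldType) (X : scheme k) (U : opens X) (n : nat)
    (t : 'I_n -> fn U) (p : mpoly n k) : fn U :=
  \sum_(m <- msupp p)
     scal U (mcoeff m p) * \prod_(i < n) t i ^+ m i.

(* O(U) = k[x_1..x_n]/(f_1..f_c) with det (d f_i / d x_j)_(i, j <= c) a unit
   of O(U): a standard smooth k-algebra. *)
Definition standard_smooth (k : fieldType) (X : scheme k) (U : opens X) : Prop :=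
  exists (n c : nat) (cn : (c <= n)%N) (t : 'I_n -> fn U)
      (f : 'I_c -> mpoly n k),
    [/\ forall a : fn U, exists p, peval t p = a,
        forall p : mpoly n k, peval t p = 0 <->
          exists q : 'I_c -> mpoly n k, p = \sum_(i < c) q i * f i
      & exists b : fn U,
          b * \det (\matrix_(i < c, j < c)
                      peval t (mderiv (widen_ord cn j) (f i))) = 1].

Definition smooth (k : fieldType) (X : scheme k) : Prop :=
  forall x : X, exists U : opens X, [/\ oset U x, affine U & standard_smooth U].

(* P is the projective space of dimension n over k, glued from the affine
   spaces U i with coordinates x i j = X_j / X_i (j != i). *)
Definition is_projective_space (k : fieldType) (n : nat) (P : scheme k) : Prop :=
  exists (U : 'I_n.+1 -> opens P) (x : forall i, 'I_n.+1 -> fn (U i)),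
    [/\ forall y : P, exists i, oset (U i) y,
        forall i, affine (U i),
        forall i, x i i = 1 /\ bijective (peval (fun j : 'I_n => x i (lift i j))),
        forall i j, (U i `&` U j : set P) = nonvanishing (x i j)
      & forall i j l (W : opens P) (Wi : W `<=` U i) (Wj : W `<=` U j),
          fres Wi (x i l) = fres Wj (x j l) * fres Wi (x i j)].

Definition closed_immersion (k : fieldType) (X Y : scheme k) (f : smor X Y) :
    Prop :=
  [/\ injective f,
      forall Z : set X, closed Z -> closed (f @` Z)
    & forall (V : opens Y) (b : fn (preim (scont f) V)) (x : X), oset V (f x) ->
        exists (W : opens Y) (a : fn W)
          (h : preim (scont f) W `<=` preim (scont f) V),
          oset W (f x) /\ comorph f W a = fres h b].

Definition projective (k : fieldType) (X : scheme k) : Prop :=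
  exists (n : nat) (P : scheme k) (f : smor X P),
    is_projective_space n P /\ closed_immersion f.

(* A left action by automorphisms of the k-scheme X; on functions,
   (g h)^# = h^# o g^#. *)
Record gaction (k : fieldType) (X : scheme k) (gT : finGroupType) := GAction {
  act :> gT -> smor X X;
  act1 : forall x, act 1%g x = x;
  act1_fn : forall (U V : opens X) (h : V `<=` preim (scont (act 1%g)) U)
    (h' : V `<=` U) (a : fn U), fres h (comorph (act 1%g) U a) = fres h' a;
  actM : forall g h x, act (g * h)%g x = act g (act h x);
  actM_fn : forall g h (U V : opens X)
    (e : V `<=` preim (scont (act (g * h)%g)) U)
    (e' : V `<=` preim (scont (act h)) (preim (scont (act g)) U)) (a : fn U),
    fres e (comorph (act (g * h)%g) U a)
      = fres e' (comorph (act h) _ (comorph (act g) U a)) }.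

(* g(U), as the preimage of U under g^-1. *)
Definition translate (k : fieldType) (X : scheme k) (gT : finGroupType)
    (s : gaction X gT) (g : gT) (U : opens X) : opens X :=
  preim (scont (s g^-1%g)) U.

(* The isomorphism O(U) -> O(gU) given by g. *)
Definition translate_fn (k : fieldType) (X : scheme k) (gT : finGroupType)
    (s : gaction X gT) (g : gT) (U : opens X) : fn U -> fn (translate s g U) :=
  comorph (s g^-1%g) U.

Record qcohSheaf (X : ringedSpace) := QCohSheaf {
  sec :> forall U : opens X, lmodType (fn U);
  mres : forall U V : opens X, V `<=` U -> sec U -> sec V;
  mresD : forall (U V : opens X) (h : V `<=` U) s t,
    mres h (s + t) = mres h s + mres h t;
  mresZ : forall (U V : opens X) (h : V `<=` U) a s,
    mres h (a *: s) = fres h a *: mres h s;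
  mres_id : forall (U : opens X) (h : U `<=` U) s, mres h s = s;
  mres_comp : forall (U V W : opens X)
    (VU : V `<=` U) (WV : W `<=` V) (WU : W `<=` U) s,
    mres WV (mres VU s) = mres WU s;
  sec_sheaf : sheaf_condition mres;
  (* X is covered by affine opens U on which the sheaf is M~, M = sec U *)
  quasi_coherent : forall x : X, exists U : opens X,
    [/\ oset U x, affine U & forall a : fn U,
      is_localization ( *:%R a) ( *:%R (fres (@nonvanishing_sub X U a) a))
        (mres (@nonvanishing_sub X U a))] }.
Arguments mres {X} q {U V} h s.

Section Equivariant.

Variables (k : fieldType) (X : scheme k) (gT : finGroupType).
Variable s : gaction X gT.

(* A linearization with respect to a subgroup H of gT.  As g is an
   automorphism, (g^* F)(U) = F(gU), on which O(U) acts through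
   O(U) -> O(gU); lin is the morphism lambda_g : F -> g^* F, and linM is
   lambda_(gh) = h^* lambda_g o lambda_h, with (gh)U and g(hU) identified by
   restriction.  That lambda_g is invertible follows from lin1 and linM. *)
Record eqSheaf (H : {group gT}) := EqSheaf {
  qsh :> qcohSheaf X;
  lin : forall g, g \in H -> forall U, qsh U -> qsh (translate s g U);
  linD : forall g (Hg : g \in H) U x y,
    lin Hg (x + y) = lin Hg (x : qsh U) + lin Hg y;
  linZ : forall g (Hg : g \in H) U (a : fn U) (x : qsh U),
    lin Hg (a *: x) = translate_fn s g a *: lin Hg x;
  lin_res : forall g (Hg : g \in H) (U V : opens X) (h : V `<=` U)
    (h' : translate s g V `<=` translate s g U) (x : qsh U),
    lin Hg (mres qsh h x) = mres qsh h' (lin Hg x);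
  lin1 : forall (H1 : 1%g \in H) (U V : opens X)
    (e : V `<=` translate s 1%g U) (e' : V `<=` U) (x : qsh U),
    mres qsh e (lin H1 x) = mres qsh e' x;
  linM : forall g h (Hg : g \in H) (Hh : h \in H) (Hgh : (g * h)%g \in H)
    (U V : opens X) (e : V `<=` translate s (g * h)%g U)
    (e' : V `<=` translate s g (translate s h U)) (x : qsh U),
    mres qsh e (lin Hgh x) = mres qsh e' (lin Hg (lin Hh x)) }.

(* The H-invariant morphisms: mor_lin says mu_g o f = g^* f o lambda_g. *)
Record eqMor (H : {group gT}) (F F' : eqSheaf H) := EqMor {
  mor :> forall U : opens X, F U -> F' U;
  morD : forall U (x y : F U), mor (x + y) = mor x + mor y;
  morZ : forall U (a : fn U) (x : F U), mor (a *: x) = a *: mor x;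
  mor_res : forall (U V : opens X) (h : V `<=` U) (x : F U),
    mor (mres F h x) = mres F' h (mor x);
  mor_lin : forall g (Hg : g \in H) U (x : F U),
    mor (lin Hg x) = lin Hg (mor x) }.

End Equivariant.
Arguments lin {k X gT s H} _ {g} Hg {U} x.
Arguments mor {k X gT s H F F'} _ U _.

(* Hom-sets are setoids: heq is equality of morphisms.  (They cannot be
   zmodTypes: those of a localization live in a larger universe.) *)
Record preadditive := Preadditive {
  obj :> Type;
  hom : obj -> obj -> Type;
  heq : forall x y, hom x y -> hom x y -> Prop;
  hid : forall x, hom x x;
  hcomp : forall x y z, hom y z -> hom x y -> hom x z;
  hzero : forall x y, hom x y;
  hadd : forall x y, hom x y -> hom x y -> hom x y;
  hopp : forall x y, hom x y -> hom x y;
  heq_refl : forall x y (f : hom x y), heq f f;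
  heq_sym : forall x y (f g : hom x y), heq f g -> heq g f;
  heq_trans : forall x y (f g h : hom x y), heq f g -> heq g h -> heq f h;
  hcomp_eq : forall x y z (g g' : hom y z) (f f' : hom x y),
    heq g g' -> heq f f' -> heq (hcomp g f) (hcomp g' f');
  hadd_eq : forall x y (f f' g g' : hom x y),
    heq f f' -> heq g g' -> heq (hadd f g) (hadd f' g');
  hopp_eq : forall x y (f f' : hom x y), heq f f' -> heq (hopp f) (hopp f');
  hcompA : forall x y z t (h : hom z t) (g : hom y z) (f : hom x y),
    heq (hcomp h (hcomp g f)) (hcomp (hcomp h g) f);
  hcomp1l : forall x y (f : hom x y), heq (hcomp (hid y) f) f;
  hcomp1r : forall x y (f : hom x y), heq (hcomp f (hid x)) f;
  haddA : forall x y (f g h : hom x y),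
    heq (hadd f (hadd g h)) (hadd (hadd f g) h);
  haddC : forall x y (f g : hom x y), heq (hadd f g) (hadd g f);
  hadd0 : forall x y (f : hom x y), heq (hadd (hzero x y) f) f;
  haddN : forall x y (f : hom x y), heq (hadd (hopp f) f) (hzero x y);
  hcompDl : forall x y z (g g' : hom y z) (f : hom x y),
    heq (hcomp (hadd g g') f) (hadd (hcomp g f) (hcomp g' f));
  hcompDr : forall x y z (g : hom y z) (f f' : hom x y),
    heq (hcomp g (hadd f f')) (hadd (hcomp g f) (hcomp g f')) }.
Arguments hid {p} x.
Arguments hzero {p} x y.

Declare Scope hom_scope.
Delimit Scope hom_scope with hom.
Local Open Scope hom_scope.
Infix "==h" := heq (at level 70, no associativity) : hom_scope.
Infix "\oh" := hcomp (at level 50, left associativity) : hom_scope.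
Infix "+h" := hadd (at level 50, left associativity) : hom_scope.

Section PreadditiveTheory.
Variable C : preadditive.
Implicit Types x y z : C.

Lemma hadd_idem x y (f : hom x y) : f +h f ==h f -> f ==h hzero x y.
Proof.
move=> e; apply: heq_trans (heq_sym (hadd0 f)) _.
apply: heq_trans (hadd_eq (heq_sym (haddN f)) (heq_refl f)) _.
apply: heq_trans (heq_sym (haddA _ _ _)) _.
apply: heq_trans (hadd_eq (heq_refl _) e) _.
exact: haddN.
Qed.

Lemma hcomp0l x y z (f : hom x y) : hzero y z \oh f ==h hzero x z.
Proof.
apply: hadd_idem; apply: heq_trans (heq_sym (hcompDl _ _ _)) _.
exact: hcomp_eq (hadd0 _) (heq_refl _).
Qed.

Lemma hcomp0r x y z (g : hom y z) : g \oh hzero x y ==h hzero x z.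
Proof.
apply: hadd_idem; apply: heq_trans (heq_sym (hcompDr _ _ _)) _.
exact: hcomp_eq (heq_refl _) (hadd0 _).
Qed.

Lemma hopp_unique x y (f g : hom x y) : f +h g ==h hzero x y -> f ==h hopp g.
Proof.
move=> e; apply: heq_trans (heq_sym (hadd0 f)) _.
apply: heq_trans (hadd_eq (heq_sym (haddN g)) (heq_refl f)) _.
apply: heq_trans (heq_sym (haddA _ _ _)) _.
apply: heq_trans (hadd_eq (heq_refl _) (haddC _ _)) _.
apply: heq_trans (hadd_eq (heq_refl _) e) _.
by apply: heq_trans (haddC _ _) _; apply: hadd0.
Qed.

Lemma hcompNl x y z (g : hom y z) (f : hom x y) :
  hopp g \oh f ==h hopp (g \oh f).
Proof.
apply: hopp_unique; apply: heq_trans (heq_sym (hcompDl _ _ _)) _.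
apply: heq_trans (hcomp_eq (haddN _) (heq_refl _)) _; exact: hcomp0l.
Qed.

Lemma hcompNr x y z (g : hom y z) (f : hom x y) :
  g \oh hopp f ==h hopp (g \oh f).
Proof.
apply: hopp_unique; apply: heq_trans (heq_sym (hcompDr _ _ _)) _.
apply: heq_trans (hcomp_eq (heq_refl _) (haddN _)) _; exact: hcomp0r.
Qed.

Lemma hoppK x y (f : hom x y) : hopp (hopp f) ==h f.
Proof.
apply: heq_sym; apply: hopp_unique; apply: heq_trans (haddC _ _) _.
exact: haddN.
Qed.

Lemma hopp0 x y : hopp (hzero x y) ==h hzero x y.
Proof. by apply: heq_sym; apply: hopp_unique; apply: hadd0. Qed.

End PreadditiveTheory.

Record functor (C D : preadditive) := Functor {
  fobj :> C -> D;
  fmap : forall x y, hom x y -> hom (fobj x) (fobj y);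
  fmap_eq : forall x y (f g : hom x y), f ==h g -> fmap f ==h fmap g;
  fmap1 : forall x, fmap (hid x) ==h hid (fobj x);
  fmapM : forall x y z (g : hom y z) (f : hom x y),
    fmap (g \oh f) ==h fmap g \oh fmap f;
  fmapD : forall x y (f g : hom x y), fmap (f +h g) ==h fmap f +h fmap g }.
Arguments fmap {C D} _ {x y} _.

Lemma fmap0 (C D : preadditive) (F : functor C D) (x y : C) :
  fmap F (hzero x y) ==h hzero (F x) (F y).
Proof.
apply: hadd_idem; apply: heq_trans (heq_sym (fmapD F _ _)) _.
exact: fmap_eq (hadd0 _).
Qed.

(* Cochain complexes: the family dif m n is zero outside n = m + 1, which
   avoids transports between the objects term (m + i + 1) and
   term (m + 1 + i). *)
Record complex (A : preadditive) := Complex {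
  term :> int -> A;
  dif : forall m n : int, hom (term m) (term n);
  dif_shape : forall m n, n <> m + 1 -> dif m n ==h hzero _ _;
  dif_dif : forall l m n, dif m n \oh dif l m ==h hzero _ _ }.
Arguments dif {A} _ m n.

Record chainMap (A : preadditive) (K L : complex A) := ChainMap {
  cmap :> forall n : int, hom (K n) (L n);
  cmapP : forall m n, dif L m n \oh cmap m ==h cmap n \oh dif K m n }.

Section Complexes.
Variable A : preadditive.
Implicit Types K L M : complex A.

Definition chain_id K : chainMap K K.
Proof.
refine (@ChainMap A K K (fun n => hid (K n)) _) => m n.
by apply: heq_trans (hcomp1r _) _; apply: heq_sym; apply: hcomp1l.
Defined.

Definition chain_comp K L M (g : chainMap L M) (f : chainMap K L) :
  chainMap K M.
Proof.
refine (@ChainMap A K M (fun n => g n \oh f n) _) => m n.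
apply: heq_trans (hcompA _ _ _) _.
apply: heq_trans (hcomp_eq (cmapP g m n) (heq_refl _)) _.
apply: heq_trans (heq_sym (hcompA _ _ _)) _.
apply: heq_trans (hcomp_eq (heq_refl _) (cmapP f m n)) _.
exact: hcompA.
Defined.

Definition chain_zero K L : chainMap K L.
Proof.
refine (@ChainMap A K L (fun n => hzero (K n) (L n)) _) => m n.
by apply: heq_trans (hcomp0r _ _) _; apply: heq_sym; apply: hcomp0l.
Defined.

Definition chain_add K L (f g : chainMap K L) : chainMap K L.
Proof.
refine (@ChainMap A K L (fun n => f n +h g n) _) => m n.
apply: heq_trans (hcompDr _ _ _) _.
apply: heq_trans (hadd_eq (cmapP f m n) (cmapP g m n)) _.
by apply: heq_sym; apply: hcompDl.
Defined.

Definition chain_opp K L (f : chainMap K L) : chainMap K L.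
Proof.
refine (@ChainMap A K L (fun n => hopp (f n)) _) => m n.
apply: heq_trans (hcompNr _ _) _.
apply: heq_trans (hopp_eq (cmapP f m n)) _.
by apply: heq_sym; apply: hcompNl.
Defined.

Definition Ch : preadditive.
Proof.
refine (@Preadditive (complex A) (@chainMap A)
  (fun K L f g => forall n, f n ==h g n) chain_id chain_comp chain_zero
  chain_add chain_opp _ _ _ _ _ _ _ _ _ _ _ _ _ _ _).
- by move=> *; apply: heq_refl.
- by move=> K L f g e n; apply: heq_sym.
- by move=> K L f g h e e' n; apply: heq_trans (e n) (e' n).
- by move=> K L M g g' f f' e e' n; apply: hcomp_eq (e n) (e' n).
- by move=> K L f f' g g' e e' n; apply: hadd_eq (e n) (e' n).
- by move=> K L f f' e n; apply: hopp_eq (e n).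
- by move=> *; apply: hcompA.
- by move=> *; apply: hcomp1l.
- by move=> *; apply: hcomp1r.
- by move=> *; apply: haddA.
- by move=> *; apply: haddC.
- by move=> *; apply: hadd0.
- by move=> *; apply: haddN.
- by move=> *; apply: hcompDl.
- by move=> *; apply: hcompDr.
Defined.

Definition hsign (i : int) (x y : A) (f : hom x y) : hom x y :=
  if odd `|i| then hopp f else f.

(* K[i], with K[i]^n = K^(n+i) and differential (-1)^i d. *)
Definition shift (i : int) (K : complex A) : complex A.
Proof.
refine (@Complex A (fun n => K (n + i))
          (fun m n => hsign i (dif K (m + i) (n + i))) _ _).
- move=> m n mn; have z : dif K (m + i) (n + i) ==h hzero _ _.
    by apply: dif_shape => e; apply: mn; apply: (addIr i); rewrite e addrAC.
  rewrite /hsign; case: odd => //.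
  by apply: heq_trans (hopp_eq z) _; apply: hopp0.
- move=> l m n; rewrite /hsign; case: odd; last exact: dif_dif.
  apply: heq_trans (hcompNl _ _) _.
  apply: heq_trans (hopp_eq (hcompNr _ _)) _.
  by apply: heq_trans (hoppK _) _; apply: dif_dif.
Defined.

End Complexes.

Definition complex_map (A B : preadditive) (F : functor A B) (K : complex A) :
  complex B.
Proof.
refine (@Complex B (fun n => F (K n)) (fun m n => fmap F (dif K m n)) _ _).
- move=> m n mn; apply: heq_trans (fmap_eq F (dif_shape K mn)) _; exact: fmap0.
- move=> l m n; apply: heq_trans (heq_sym (fmapM F _ _)) _.
  apply: heq_trans (fmap_eq F (dif_dif K l m n)) _; exact: fmap0.
Defined.

(* The localization C[W^-1]: morphisms are formal sums and composites of
   morphisms of C and of inverses of morphisms in W, modulo the relations of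
   preadditive categories, those of C, and w^-1 o w = 1, w o w^-1 = 1.  It is
   universal among preadditive categories under C inverting W.  When C has
   finite direct sums and W is stable under them, it is also universal among
   all categories under C inverting W (that localization being additive). *)
Section Localization.
Variables (C : preadditive) (W : forall x y : C, hom x y -> Prop).

Inductive locHom : C -> C -> Type :=
| locOf x y (f : hom x y) : locHom x y
| locInv x y (w : hom x y) of W w : locHom y x
| locComp x y z of locHom y z & locHom x y : locHom x z
| locAdd x y of locHom x y & locHom x y : locHom x y
| locOpp x y of locHom x y : locHom x y.

Inductive locEq : forall x y, locHom x y -> locHom x y -> Prop :=
| leRefl x y (f : locHom x y) : locEq f f
| leSym x y (f g : locHom x y) : locEq f g -> locEq g f
| leTrans x y (f g h : locHom x y) : locEq f g -> locEq g h -> locEq f h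
| leComp x y z (g g' : locHom y z) (f f' : locHom x y) :
    locEq g g' -> locEq f f' -> locEq (locComp g f) (locComp g' f')
| leAdd x y (f f' g g' : locHom x y) :
    locEq f f' -> locEq g g' -> locEq (locAdd f g) (locAdd f' g')
| leOpp x y (f f' : locHom x y) : locEq f f' -> locEq (locOpp f) (locOpp f')
| leCompA x y z t (h : locHom z t) (g : locHom y z) (f : locHom x y) :
    locEq (locComp h (locComp g f)) (locComp (locComp h g) f)
| leComp1l x y (f : locHom x y) : locEq (locComp (locOf (hid y)) f) f
| leComp1r x y (f : locHom x y) : locEq (locComp f (locOf (hid x))) f
| leAddA x y (f g h : locHom x y) :
    locEq (locAdd f (locAdd g h)) (locAdd (locAdd f g) h)
| leAddC x y (f g : locHom x y) : locEq (locAdd f g) (locAdd g f)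
| leAdd0 x y (f : locHom x y) : locEq (locAdd (locOf (hzero x y)) f) f
| leAddN x y (f : locHom x y) :
    locEq (locAdd (locOpp f) f) (locOf (hzero x y))
| leCompDl x y z (g g' : locHom y z) (f : locHom x y) :
    locEq (locComp (locAdd g g') f) (locAdd (locComp g f) (locComp g' f))
| leCompDr x y z (g : locHom y z) (f f' : locHom x y) :
    locEq (locComp g (locAdd f f')) (locAdd (locComp g f) (locComp g f'))
| leOf x y (f g : hom x y) : f ==h g -> locEq (locOf f) (locOf g)
| leOfComp x y z (g : hom y z) (f : hom x y) :
    locEq (locOf (g \oh f)) (locComp (locOf g) (locOf f))
| leOfAdd x y (f g : hom x y) :
    locEq (locOf (f +h g)) (locAdd (locOf f) (locOf g))
| leInvl x y (w : hom x y) (Ww : W w) :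
    locEq (locComp (locInv Ww) (locOf w)) (locOf (hid x))
| leInvr x y (w : hom x y) (Ww : W w) :
    locEq (locComp (locOf w) (locInv Ww)) (locOf (hid y)).

Definition localization : preadditive :=
  @Preadditive C locHom locEq (fun x => locOf (hid x)) locComp
    (fun x y => locOf (hzero x y)) locAdd locOpp
    leRefl leSym leTrans leComp leAdd leOpp leCompA leComp1l leComp1r
    leAddA leAddC leAdd0 leAddN leCompDl leCompDr.

End Localization.

Section DirectSums.
Variable C : preadditive.

Fixpoint hsum (x y : C) (I : Type) (r : seq I) (f : I -> hom x y) : hom x y :=
  if r is i :: r' then f i +h hsum r' f else hzero x y.

Definition is_coproduct (I : Type) (N : I -> C) (S : C)
    (inj : forall i, hom (N i) S) : Prop :=
  forall (y : C) (f : forall i, hom (N i) y),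
    exists h : hom S y, (forall i, h \oh inj i ==h f i) /\
      forall h' : hom S y, (forall i, h' \oh inj i ==h f i) -> h' ==h h.

(* The canonical map from the direct sum of the groups Hom(T, N i), i.e. the
   finitely supported families, to Hom(T, S) is bijective whenever S is the
   direct sum of the N i. *)
Definition hom_commutes_with_sums (T : C) : Prop :=
  forall (I : choiceType) (N : I -> C) (S : C) (inj : forall i, hom (N i) S),
    is_coproduct inj ->
  let sum_of (h : hom T S) (f : forall i, hom T (N i)) :=
    exists r : seq I, [/\ uniq r, (forall i, i \notin r -> f i ==h hzero T (N i))
                        & h ==h hsum r (fun i => inj i \oh f i)] in
  forall h : hom T S, exists f : forall i, hom T (N i), sum_of h f /\
    forall f', sum_of h f' -> forall i, f' i ==h f i.

End DirectSums.

Section EquivariantCategory.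

Variables (k : fieldType) (X : scheme k) (gT : finGroupType).
Variable s : gaction X gT.

Section FixedGroup.
Variable H : {group gT}.
Implicit Types F : eqSheaf s H.

Lemma mres0 F (U V : opens X) (h : V `<=` U) : mres F h 0 = 0.
Proof. by apply: (addrI (mres F h 0)); rewrite -mresD !addr0. Qed.

Lemma mresN F (U V : opens X) (h : V `<=` U) x : mres F h (- x) = - mres F h x.
Proof. by apply: (addrI (mres F h x)); rewrite -mresD !subrr mres0. Qed.

Lemma lin0 F g (Hg : g \in H) U : lin F Hg (0 : F U) = 0.
Proof. by apply: (addrI (lin F Hg (0 : F U))); rewrite -linD !addr0. Qed.

Lemma linN F g (Hg : g \in H) U (x : F U) : lin F Hg (- x) = - lin F Hg x.
Proof. by apply: (addrI (lin F Hg x)); rewrite -linD !subrr lin0. Qed.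

Definition eq_id F : eqMor F F.
Proof. by refine (@EqMor _ _ _ _ _ F F (fun U x => x) _ _ _ _). Defined.

Definition eq_comp F F' F'' (g : eqMor F' F'') (f : eqMor F F') : eqMor F F''.
Proof.
refine (@EqMor _ _ _ _ _ F F'' (fun U x => g U (f U x)) _ _ _ _).
- by move=> U x y; rewrite !morD.
- by move=> U a x; rewrite !morZ.
- by move=> U V h x; rewrite !mor_res.
- by move=> a Ha U x; rewrite !mor_lin.
Defined.

Definition eq_zero F F' : eqMor F F'.
Proof.
refine (@EqMor _ _ _ _ _ F F' (fun U x => 0) _ _ _ _).
- by move=> *; rewrite addr0.
- by move=> *; rewrite scaler0.
- by move=> *; rewrite mres0.
- by move=> *; rewrite lin0.
Defined.

Definition eq_add F F' (f g : eqMor F F') : eqMor F F'.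
Proof.
refine (@EqMor _ _ _ _ _ F F' (fun U x => f U x + g U x) _ _ _ _).
- by move=> U x y; rewrite !morD addrACA.
- by move=> U a x; rewrite !morZ scalerDr.
- by move=> U V h x; rewrite !mor_res mresD.
- by move=> a Ha U x; rewrite !mor_lin linD.
Defined.

Definition eq_opp F F' (f : eqMor F F') : eqMor F F'.
Proof.
refine (@EqMor _ _ _ _ _ F F' (fun U x => - f U x) _ _ _ _).
- by move=> U x y; rewrite !morD opprD.
- by move=> U a x; rewrite !morZ scalerN.
- by move=> U V h x; rewrite !mor_res mresN.
- by move=> a Ha U x; rewrite !mor_lin linN.
Defined.

Definition Qcoh : preadditive.
Proof.
refine (@Preadditive (eqSheaf s H) (fun F F' => eqMor F F')
  (fun F F' f g => forall U x, f U x = g U x) eq_id eq_comp eq_zero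
  eq_add eq_opp _ _ _ _ _ _ _ _ _ _ _ _ _ _ _) => //=.
- by move=> F F' f g h e e' U x; rewrite e.
- by move=> F F' F'' g g' f f' e e' U x; rewrite e' e.
- by move=> F F' f f' g g' e e' U x; rewrite e e'.
- by move=> F F' f f' e U x; rewrite e.
- by move=> *; rewrite addrA.
- by move=> *; rewrite addrC.
- by move=> *; rewrite add0r.
- by move=> *; rewrite addNr.
- by move=> *; rewrite morD.
Defined.

Definition app F F' (f : @hom Qcoh F F') (U : opens X) (x : F U) : F' U :=
  (f : eqMor F F') U x.

Definition cocycle (K : complex Qcoh) (n : int) (U : opens X)
    (x : (K n : eqSheaf s H) U) : Prop :=
  app (dif K n (n + 1)) x = 0.

Definition local_boundary (K : complex Qcoh) (n : int) (U : opens X)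
    (x : (K n : eqSheaf s H) U) : Prop :=
  forall p, oset U p -> exists (V : opens X) (h : V `<=` U)
    (u : (K (n - 1) : eqSheaf s H) V),
    oset V p /\ app (dif K (n - 1) n) u = mres (K n : eqSheaf s H) h x.

(* f induces isomorphisms (injective and surjective morphisms) on the
   cohomology sheaves, i.e. on the sheaves associated with the presheaves
   U |-> H^n(K(U)). *)
Definition quasi_iso (K L : Ch Qcoh) (f : @hom (Ch Qcoh) K L) : Prop :=
  forall n : int,
    (forall (U : opens X) (x : ((K : complex Qcoh) n : eqSheaf s H) U),
       cocycle x -> local_boundary (app ((f : chainMap K L) n) x) ->
       local_boundary x) /\
    (forall (U : opens X) (y : ((L : complex Qcoh) n : eqSheaf s H) U),
       cocycle y -> forall p, oset U p ->
       exists (V : opens X) (h : V `<=` U)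
         (x : ((K : complex Qcoh) n : eqSheaf s H) V)
         (u : ((L : complex Qcoh) (n - 1) : eqSheaf s H) V),
         [/\ oset V p, cocycle x
           & mres ((L : complex Qcoh) n : eqSheaf s H) h y
             = app ((f : chainMap K L) n) x
               + app (dif (L : complex Qcoh) (n - 1) n) u]).

(* D(Qcoh_H(X)) *)
Definition Dqcoh : preadditive := localization quasi_iso.

(* RHom_H(T, N) = 0 is stated on its cohomology groups Hom_H(T, N[i]), and N
   is zero when its identity is. *)
Definition tilting (T : Dqcoh) : Prop :=
  [/\ forall i : int, i <> 0 ->
        forall f : @hom Dqcoh T (shift i T), f ==h hzero T (shift i T : Dqcoh),
      forall N : Dqcoh,
        (forall (i : int) (f : @hom Dqcoh T (shift i N)),
           f ==h hzero T (shift i N : Dqcoh)) ->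
        hid N ==h hzero N N
    & hom_commutes_with_sums T].

End FixedGroup.

Section Restriction.
Variables (H K : {group gT}) (sKH : K \subset H).

Definition res_sheaf (F : eqSheaf s H) : eqSheaf s K.
Proof.
refine (@EqSheaf _ _ _ _ K F (fun g Kg U => @lin _ _ _ _ _ F g (fintype.subsetP sKH g Kg) U) _ _ _ _ _).
- by move=> *; apply: linD.
- by move=> *; apply: linZ.
- by move=> *; apply: lin_res.
- by move=> *; apply: lin1.
- by move=> *; apply: linM.
Defined.

Definition res_mor (F F' : eqSheaf s H) (f : eqMor F F') :
  eqMor (res_sheaf F) (res_sheaf F').
Proof.
refine (@EqMor _ _ _ _ _ (res_sheaf F) (res_sheaf F') (fun U x => f U x) _ _ _ _).
- by move=> *; apply: (morD f).
- by move=> *; apply: (morZ f).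
- by move=> *; apply: (mor_res f).
- by move=> *; apply: (mor_lin f).
Defined.

Definition restriction : functor (Qcoh H) (Qcoh K).
Proof.
by refine (@Functor (Qcoh H) (Qcoh K) res_sheaf res_mor _ _ _ _).
Defined.

End Restriction.

(* For the trivial group, lambda_1 = id leaves no structure. *)
Definition forget (H : {group gT}) (T : Dqcoh H) : Dqcoh 1%G :=
  complex_map (restriction (sub1G H)) T.

(* T (x) W for the representation of H on W = k^n (row vectors) attached to W :
   mx_representation k H n.  In mathcomp, v |-> v *m W g is a right action, so
   g acts on the left by v |-> v *m W g^-1.  On the sections of
   F (x)_O_X (O_X (x)_k W) over U, i.e. the sums of the x_i (x) e_i with x_i
   in F(U), lambda_g is then given by
     x_i (x) e_i |-> \sum_j (W g^-1)_(i, j) lambda_g(x_i) (x) e_j. *)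
Section Tensor.
Variables (H : {group gT}) (n : nat) (W : mx_representation k H n).

Lemma scal_res (U V : opens X) (h : V `<=` U) c : fres h (scal U c) = scal V c.
Proof. exact: fres_comp. Qed.

Lemma scalM (U : opens X) c d : scal U (c * d) = scal U c * scal U d.
Proof. by rewrite /scal !rmorphM. Qed.

Lemma scal1 (U : opens X) : scal U 1 = 1.
Proof. by rewrite /scal !rmorph1. Qed.

Lemma scal0 (U : opens X) : scal U 0 = 0.
Proof. by rewrite /scal !rmorph0. Qed.

Lemma scal_sum (U : opens X) (I : finType) (c : I -> k) :
  scal U (\sum_i c i) = \sum_i scal U (c i).
Proof. by rewrite /scal !rmorph_sum. Qed.

Section TensorSheaf.
Variable F : eqSheaf s H.

Lemma mres_sum (U V : opens X) (h : V `<=` U) (I : finType) (x : I -> F U) :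
  mres F h (\sum_i x i) = \sum_i mres F h (x i).
Proof. by apply: (big_morph (mres F h)) => [y z|]; rewrite ?mresD ?mres0. Qed.

Lemma lin_sum g (Hg : g \in H) U (I : finType) (x : I -> F U) :
  lin F Hg (\sum_i x i) = \sum_i lin F Hg (x i).
Proof. by apply: (big_morph (fun y => lin F Hg y)) => [y z|]; rewrite ?linD ?lin0. Qed.

Lemma lin_scal g (Hg : g \in H) U c (x : F U) :
  lin F Hg (scal U c *: x) = scal _ c *: lin F Hg x.
Proof. by rewrite linZ /translate_fn comorph_scal. Qed.

Definition tsec (U : opens X) : lmodType (fn U) := {ffun 'I_n -> F U}.

Definition tres (U V : opens X) (h : V `<=` U) (x : tsec U) : tsec V :=
  [ffun i => mres F h (x i)].

Definition tlin g (Hg : g \in H) U (x : tsec U) : tsec (translate s g U) :=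
  [ffun j => \sum_i scal _ (W g^-1%g i j) *: lin F Hg (x i)].

Lemma tsheaf_condition : sheaf_condition tres.
Proof.
move=> I V U VU cov x compat.
have loc j : exists! t : F U, forall i, mres F (VU i) t = x i j.
  apply: (@sec_sheaf X F I V U VU cov) => i i' O Oi Oi'.
  by have /ffunP/(_ j) := compat i i' O Oi Oi'; rewrite !ffunE.
have [t tP] := choice loc.
exists [ffun j => t j : F U]; split=> [i|y yP].
  by apply/ffunP => j; rewrite !ffunE; case: (tP j).
apply/ffunP => j; rewrite ffunE; case: (tP j) => _; apply=> i.
by rewrite -(yP i) ffunE.
Qed.

Lemma iter_ffun (U : opens X) (a : fn U) e (x : tsec U) j :
  iter e ( *:%R a) x j = iter e ( *:%R a) (x j).
Proof. by elim: e => //= e IH; rewrite ffunE IH. Qed.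

Lemma iter_scale (A : comPzRingType) (V : lmodType A) (a : A) e (x : V) :
  iter e ( *:%R a) x = a ^+ e *: x.
Proof. by elim: e => [|e IH] /=; rewrite ?scale1r // IH scalerA exprS. Qed.

Lemma tquasi_coherent (x : X) : exists U : opens X,
  [/\ oset U x, affine U & forall a : fn U,
    is_localization ( *:%R a) ( *:%R (fres (@nonvanishing_sub X U a) a))
      (tres (@nonvanishing_sub X U a))].
Proof.
have [U [Ux affU locU]] := quasi_coherent F x; exists U; split=> // a.
have [[inv invK Kinv] surj ker] := locU a.
set h := @nonvanishing_sub X U a in inv invK Kinv surj ker *.
split.
- exists (fun y : tsec _ => [ffun i => inv (y i)] : tsec _) => y;
    by apply/ffunP => i; rewrite !ffunE ?invK ?Kinv.
- move=> y.
  have [z zP] := choice (fun i => surj (y i)).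
  have [e eP] := choice zP.
  pose N := (\sum_i e i)%N.
  have eN i : (e i <= N)%N by rewrite /N (bigD1 i) //= leq_addr.
  exists [ffun i => iter (N - e i) ( *:%R a) (z i) : F U], N.
  apply/ffunP => i; rewrite iter_ffun !ffunE !iter_scale mresZ rmorphXn -eP.
  by rewrite iter_scale scalerA -exprD subnK.
- move=> y /ffunP y0.
  have y0i i : mres F h (y i) = 0 by have := y0 i; rewrite !ffunE.
  have [e eP] := choice (fun i => ker _ (y0i i)).
  pose N := (\sum_i e i)%N.
  have eN i : (e i <= N)%N by rewrite /N (bigD1 i) //= leq_addr.
  exists N; apply/ffunP => i; rewrite iter_ffun ffunE.
  by have := eP i; rewrite -(subnK (eN i)) !iter_scale exprD -scalerA => ->; rewrite scaler0.
Qed.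

Definition tqcoh : qcohSheaf X.
Proof.
refine (@QCohSheaf X tsec tres _ _ _ _ tsheaf_condition tquasi_coherent).
- by move=> U V h x y; apply/ffunP => i; rewrite !ffunE mresD.
- by move=> U V h a x; apply/ffunP => i; rewrite !ffunE mresZ.
- by move=> U h x; apply/ffunP => i; rewrite !ffunE mres_id.
- by move=> U V Z VU ZV ZU x; apply/ffunP => i; rewrite !ffunE (mres_comp VU ZV ZU).
Defined.

Definition tensor_sheaf : eqSheaf s H.
Proof.
refine (@EqSheaf _ _ _ _ H tqcoh tlin _ _ _ _ _).
- move=> g Hg U x y; apply/ffunP => j; rewrite !ffunE -big_split /=.
  by apply: eq_bigr => i _; rewrite ffunE linD scalerDr.
- move=> g Hg U a x; apply/ffunP => j; rewrite !ffunE scaler_sumr.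
  by apply: eq_bigr => i _; rewrite ffunE linZ !scalerA mulrC.
- move=> g Hg U V h h' x; apply/ffunP => j; rewrite !ffunE mres_sum.
  apply: eq_bigr => i _.
  by rewrite ffunE (lin_res _ _ h') mresZ scal_res.
- move=> H1 U V e e' x; apply/ffunP => j; rewrite !ffunE mres_sum (bigD1 j) //=.
  rewrite big1 => [|i ij]; last first.
    by rewrite mresZ scal_res invg1 repr_mx1 mxE (negPf ij) scal0 scale0r.
  by rewrite addr0 mresZ scal_res invg1 repr_mx1 mxE eqxx scal1 scale1r (lin1 _ _ e').
- move=> g h Hg Hh Hgh U V e e' x; apply/ffunP => j; rewrite !ffunE !mres_sum.
  rewrite invMg repr_mxM ?groupV //.
  under [RHS]eq_bigr => i _.
    rewrite ffunE lin_sum mresZ mres_sum scaler_sumr.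
    under eq_bigr => l _ do rewrite lin_scal mresZ !scal_res scalerA.
    over.
  rewrite exchange_big /=; apply: eq_bigr => l _.
  rewrite mresZ scal_res (linM Hg Hh Hgh e e') mxE scal_sum scaler_suml.
  by apply: eq_bigr => i _; rewrite scalM mulrC.
Defined.

End TensorSheaf.

Definition tensor_mor (F F' : eqSheaf s H) (f : eqMor F F') :
  eqMor (tensor_sheaf F) (tensor_sheaf F').
Proof.
refine (@EqMor _ _ _ _ _ (tensor_sheaf F) (tensor_sheaf F')
  (fun U x => [ffun i => f U (x i)]) _ _ _ _).
- by move=> U x y; apply/ffunP => i; rewrite !ffunE morD.
- by move=> U a x; apply/ffunP => i; rewrite !ffunE morZ.
- by move=> U V h x; apply/ffunP => i; rewrite !ffunE mor_res.
- move=> g Hg U x; apply/ffunP => j; rewrite !ffunE.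
  have f0 : f (translate s g U) 0 = 0.
    by rewrite -(scale0r (0 : F (translate s g U))) morZ scale0r.
  rewrite (big_morph (f (translate s g U)) (morD f (U := _)) f0).
  by apply: eq_bigr => i _; rewrite morZ mor_lin ffunE.
Defined.

Definition tensor_functor : functor (Qcoh H) (Qcoh H).
Proof.
refine (@Functor (Qcoh H) (Qcoh H) tensor_sheaf tensor_mor _ _ _ _) => /=.
- by move=> F F' f g e U x; apply/ffunP => i; rewrite !ffunE e.
- by move=> F U x; apply/ffunP => i; rewrite !ffunE.
- by move=> F F' F'' g f U x; apply/ffunP => i; rewrite !ffunE.
- by move=> F F' f g U x; apply/ffunP => i; rewrite !ffunE.
Defined.

Definition tensor (T : Dqcoh H) : Dqcoh H := complex_map tensor_functor T.

End Tensor.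

End EquivariantCategory.

(* Main.v *)
From HB Require Import structures.
From mathcomp Require Import all_boot all_algebra all_fingroup.
From mathcomp Require Import mxrepresentation.
From mathcomp Require Import boolp classical_sets topology_structure filter.
Require Import Defs.
From Corelib Require Import RelationClasses.
From Corelib Require Morphisms Setoid.

Set Implicit Arguments.
Unset Strict Implicit.
Unset Printing Implicit Defensive.

Import GRing.Theory.
Local Open Scope classical_set_scope.
Local Open Scope ring_scope.
Local Open Scope hom_scope.

(** Let Res forget linearizations, and let Ind F be the direct sum of the
    sheaves g^* F, permuted by G.  The object T (x) k[G] is induced: untwisting
    its components by the linearization of T, that is, sending (x_g) to
    (lambda_g x_g), is an isomorphism onto Ind (Res T) ([tens_to]).

    As G is finite, Ind is both left and right adjoint to Res, and this holds
    for quasi-coherent sheaves, with explicit units and counits.  Both functors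
    preserve quasi-isomorphisms ([Ind_quasi_iso]: exactness is checked at
    points, and a point has finitely many translates), so that units and
    counits descend to complexes and to the localization
    ([localized_adjunction]).  Hence Hom_G(T (x) k[G], N) is Hom(Res T, Res N),
    naturally in N; this is [tens_universal], in the form of a universal arrow.

    The three conditions follow.
    - Res (T (x) k[G]) is a sum of copies of Res T, and so are its shifts; the
      vanishing of the Hom(Res T, Res T[i]) gives condition (i)
      ([shift_tens_eq0]).
    - If RHom_G(T (x) k[G], N) = 0 then RHom(Res T, Res N) = 0, so Res N = 0.
      The composite N -> Ind (Res N) -> N of the unit of one adjunction and the
      counit of the other is multiplication by the order of G, which is
      invertible in k; as it factors through Ind 0, N = 0
      ([DRes_conservative]).
    - Res is also a left adjoint, so it preserves direct sums, and
      Hom(Res T, Res -) commutes with them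
      ([universal_arrow_commutes_with_sums]).

    The geometric point is that Ind F is quasi-coherent: around x one needs a
    single affine open set U such that F is given by a module on gU for every g.
    It is found among the common distinguished open subsets of the affine open
    sets obtained for each g separately ([common_tilde]). *)

(** * Setoid reasoning in preadditive categories *)

#[local] Instance heq_equivalence (C : preadditive) (x y : C) :
  Equivalence (@heq C x y).
Proof.
split; [exact: heq_refl | exact: heq_sym | by move=> f g h; exact: heq_trans].
Qed.

#[local] Instance hcomp_proper (C : preadditive) (x y z : C) :
  Morphisms.Proper (Morphisms.respectful (@heq C y z)
    (Morphisms.respectful (@heq C x y) (@heq C x z))) (@hcomp C x y z).
Proof. by move=> g g' eg f f' ef; apply: hcomp_eq. Qed.

#[local] Instance hadd_proper (C : preadditive) (x y : C) :
  Morphisms.Proper (Morphisms.respectful (@heq C x y)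
    (Morphisms.respectful (@heq C x y) (@heq C x y))) (@hadd C x y).
Proof. by move=> g g' eg f f' ef; apply: hadd_eq. Qed.

#[local] Instance hopp_proper (C : preadditive) (x y : C) :
  Morphisms.Proper (Morphisms.respectful (@heq C x y) (@heq C x y)) (@hopp C x y).
Proof. by move=> f f' ef; apply: hopp_eq. Qed.

#[local] Instance fmap_proper (C D : preadditive) (F : functor C D) (x y : C) :
  Morphisms.Proper (Morphisms.respectful (@heq C x y) (@heq D (F x) (F y))) (@fmap C D F x y).
Proof. by move=> f f' ef; apply: fmap_eq. Qed.

#[local] Hint Resolve heq_refl : core.

Lemma fmapN (C D : preadditive) (F : functor C D) (x y : C) (f : hom x y) :
  fmap F (hopp f) ==h hopp (fmap F f).
Proof. by apply: hopp_unique; rewrite -fmapD haddN fmap0. Qed.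

Lemma fmap_hsign (C D : preadditive) (F : functor C D) i (x y : C)
  (f : hom x y) : fmap F (hsign i f) ==h hsign i (fmap F f).
Proof. by rewrite /hsign; case: odd; [exact: fmapN | by []]. Qed.

Lemma hcomp_hsignl (C : preadditive) i (x y z : C) (g : hom y z)
  (f : hom x y) : hsign i g \oh f ==h hsign i (g \oh f).
Proof. by rewrite /hsign; case: odd; [exact: hcompNl | by []]. Qed.

Lemma hcomp_hsignr (C : preadditive) i (x y z : C) (g : hom y z)
  (f : hom x y) : g \oh hsign i f ==h hsign i (g \oh f).
Proof. by rewrite /hsign; case: odd; [exact: hcompNr | by []]. Qed.

#[local] Instance hsign_proper (C : preadditive) i (x y : C) :
  Morphisms.Proper (Morphisms.respectful (@heq C x y) (@heq C x y)) (@hsign C i x y).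
Proof. by move=> f f' ef; rewrite /hsign; case: odd => //; rewrite ef. Qed.

Section FiniteSums.
Variables (C : preadditive) (I : Type).

Lemma eq_hsum (x y : C) (r : seq I) (f g : I -> hom x y) :
  (forall i, f i ==h g i) -> hsum r f ==h hsum r g.
Proof. by move=> e; elim: r => [|i r IH] /=; [by [] | rewrite e IH]. Qed.

Lemma hcomp_suml (x y z : C) (r : seq I) (g : I -> hom y z) (f : hom x y) :
  hsum r g \oh f ==h hsum r (fun i => g i \oh f).
Proof.
by elim: r => [|i r IH] /=; [exact: hcomp0l | rewrite hcompDl IH].
Qed.

Lemma fmap_sum (D : preadditive) (F : functor C D) (x y : C) (r : seq I)
  (f : I -> hom x y) : fmap F (hsum r f) ==h hsum r (fun i => fmap F (f i)).
Proof. by elim: r => [|i r IH] /=; [exact: fmap0 | rewrite fmapD IH]. Qed.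

Lemma hsum0 (x y : C) (r : seq I) (f : I -> hom x y) :
  (forall i, f i ==h hzero x y) -> hsum r f ==h hzero x y.
Proof.
by move=> e; elim: r => [|i r IH] /=; [by [] | rewrite e IH hadd0].
Qed.

End FiniteSums.

(** * Functors, adjunctions and universal arrows *)

Definition functor_id (C : preadditive) : functor C C.
Proof. by refine (@Functor C C id (fun x y f => f) _ _ _ _); intros. Defined.

Definition functor_comp (C D E : preadditive) (G : functor D E)
  (F : functor C D) : functor C E.
Proof.
refine (@Functor C E (fun x => G (F x)) (fun x y f => fmap G (fmap F f))
  _ _ _ _) => [x y f g e|x|x y z g f|x y f g].
- by rewrite e.
- by rewrite !fmap1.
- by rewrite !fmapM.
- by rewrite !fmapD.
Defined.

Definition natural (C D : preadditive) (F G : functor C D)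
    (eta : forall x, hom (F x) (G x)) : Prop :=
  forall x y (f : hom x y), eta y \oh fmap F f ==h fmap G f \oh eta x.

Record adjunction (C D : preadditive) (L : functor D C) (R : functor C D) :=
  Adjunction {
  unit : forall x : D, hom x (R (L x));
  counit : forall y : C, hom (L (R y)) y;
  unitP : natural (F := functor_id D) (G := functor_comp R L) unit;
  counitP : natural (F := functor_comp L R) (G := functor_id C) counit;
  counit_unit : forall x : D, counit (L x) \oh fmap L (unit x) ==h hid (L x);
  unit_counit : forall y : C, fmap R (counit y) \oh unit (R y) ==h hid (R y) }.
Arguments unit {C D L R} a x.
Arguments counit {C D L R} a y.

(** A universal arrow from an object to a functor is the part of a left adjoint
    that concerns this object; unlike L x, its target may be replaced by an
    isomorphic object. *)
Definition universal_arrow (C D : preadditive) (R : functor C D) (T : D)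
    (P : C) (u : hom T (R P)) : Prop :=
  forall (N : C) (f : hom T (R N)), exists h : hom P N,
    fmap R h \oh u ==h f /\ forall h', fmap R h' \oh u ==h f -> h' ==h h.

Section Adjunction.
Variables (C D : preadditive) (L : functor D C) (R : functor C D).
Variable adj : adjunction L R.

Lemma adjunction_universal (x : D) (P : C) (phi : hom P (L x))
    (psi : hom (L x) P) :
  psi \oh phi ==h hid P -> phi \oh psi ==h hid (L x) ->
  universal_arrow (fmap R psi \oh unit adj x).
Proof.
move=> psiK phiK N f.
exists (counit adj N \oh fmap L f \oh phi); split=> [|h' <-].
  rewrite !fmapM !hcompA -(hcompA _ (fmap R phi)) -(fmapM R phi) phiK fmap1.
  rewrite hcomp1r -hcompA.
  have /= <- := unitP adj f.
  by rewrite hcompA unit_counit hcomp1l.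
rewrite !fmapM !hcompA.
have /= -> := counitP adj h'.
have /= e := counitP adj psi.
rewrite -(hcompA h') e hcompA -!(hcompA (h' \oh psi)) (hcompA _ _ phi).
by rewrite counit_unit hcomp1r -hcompA psiK hcomp1r.
Qed.

(** A morphism L S -> y is a morphism S -> R y, hence a family of morphisms
    N i -> R y, hence a family of morphisms L (N i) -> y. *)
Lemma left_adjoint_coproduct (I : Type) (N : I -> D) (S : D)
    (inj : forall i, hom (N i) S) :
  is_coproduct inj -> is_coproduct (fun i => fmap L (inj i)).
Proof.
move=> cop y f.
have [h [hP h_uniq]] := cop (R y) (fun i => fmap R (f i) \oh unit adj (N i)).
exists (counit adj y \oh fmap L h); split=> [i|h' h'P].
  rewrite -hcompA -fmapM hP fmapM hcompA.
  have /= -> := counitP adj (f i).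
  by rewrite -hcompA counit_unit hcomp1r.
rewrite -(h_uniq (fmap R h' \oh unit adj S)).
  rewrite fmapM hcompA.
  have /= -> := counitP adj h'.
  by rewrite -hcompA counit_unit hcomp1r.
move=> i; rewrite -hcompA.
have /= -> := unitP adj (inj i).
by rewrite hcompA -fmapM h'P.
Qed.

End Adjunction.

Section UniversalArrow.
Variables (C D : preadditive) (R : functor C D) (T : D) (P : C).
Variables (u : hom T (R P)) (univ : universal_arrow u).

Lemma universal_arrow_eq N (h h' : hom P N) :
  fmap R h \oh u ==h fmap R h' \oh u -> h ==h h'.
Proof.
move=> e; have [h0 [_ h0P]] := univ (fmap R h' \oh u).
by rewrite (h0P h e) (h0P h').
Qed.

Lemma universal_arrow_eq0 N (h : hom P N) :
  fmap R h \oh u ==h hzero T (R N) -> h ==h hzero P N.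
Proof. by move=> e; apply: universal_arrow_eq; rewrite fmap0 hcomp0l. Qed.

(** Composing with u identifies Hom(P, N) with Hom(T, R N), additively in the
    morphism and naturally in N. *)
Lemma universal_arrow_commutes_with_sums :
  (forall (I : Type) (N : I -> C) (S : C) (inj : forall i, hom (N i) S),
     is_coproduct inj -> is_coproduct (fun i => fmap R (inj i))) ->
  hom_commutes_with_sums T -> hom_commutes_with_sums P.
Proof.
move=> Rcop Tsum I N S inj cop /= h.
have [f [[r [r_uniq fr fP]] f_uniq]] := Tsum _ _ _ _ (Rcop _ _ _ _ cop)
  (fmap R h \oh u).
pose g i := projT1 (cid (univ (f i))).
have gP i : fmap R (g i) \oh u ==h f i /\
    forall h', fmap R h' \oh u ==h f i -> h' ==h g i.
  exact: projT2 (cid (univ (f i))).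
exists g; split.
  exists r; split=> // [i /fr fi0|].
    by apply: universal_arrow_eq0; case: (gP i) => ->.
  apply: universal_arrow_eq; rewrite fP fmap_sum hcomp_suml.
  by apply: eq_hsum => i; rewrite fmapM -hcompA; case: (gP i) => ->.
move=> g' [r' [r'_uniq g'r' g'P]] i; case: (gP i) => _; apply.
apply: (f_uniq (fun i => fmap R (g' i) \oh u)); exists r'.
split=> // [j /g'r' g'j0|]; first by rewrite g'j0 fmap0 hcomp0l.
rewrite g'P fmap_sum hcomp_suml.
by apply: eq_hsum => j; rewrite fmapM -hcompA.
Qed.

End UniversalArrow.

(** * Passing to complexes *)

Section Complexes.
Variables A B : preadditive.

Definition ch_fmap (F : functor A B) (K L : complex A) (f : chainMap K L) :
  chainMap (complex_map F K) (complex_map F L).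
Proof.
refine (@ChainMap B (complex_map F K) (complex_map F L)
  (fun n => fmap F (f n)) _) => m n.
by rewrite /= -!fmapM cmapP.
Defined.

Definition ch_functor (F : functor A B) : functor (Ch A) (Ch B).
Proof.
refine (@Functor (Ch A) (Ch B) (complex_map F) (ch_fmap F) _ _ _ _).
- by move=> K L f g e n; apply: fmap_eq; apply: e.
- by move=> K n /=; rewrite fmap1.
- by move=> K L M g f n /=; rewrite fmapM.
- by move=> K L f g n /=; rewrite fmapD.
Defined.

End Complexes.

Lemma hsum_ch (A : preadditive) (K L : complex A) (I : Type) (r : seq I)
    (f : I -> chainMap K L) n :
  (@hsum (Ch A) K L I r f : chainMap K L) n ==h hsum r (fun j => f j n).
Proof.
by elim: r => [|j r IH]; [exact: heq_refl | exact: hadd_eq (heq_refl (f j n)) IH].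
Qed.

Section ComplexAdjunction.
Variables (A B : preadditive).
Variables (L : functor B A) (R : functor A B) (adj : adjunction L R).

Definition ch_unit (K : complex B) :
  chainMap K (complex_map R (complex_map L K)).
Proof.
refine (@ChainMap B K (complex_map R (complex_map L K))
  (fun n => unit adj (K n)) _) => m n.
by have /= -> := unitP adj (dif K m n).
Defined.

Definition ch_counit (K : complex A) :
  chainMap (complex_map L (complex_map R K)) K.
Proof.
refine (@ChainMap A (complex_map L (complex_map R K)) K
  (fun n => counit adj (K n)) _) => m n.
by have /= <- := counitP adj (dif K m n).
Defined.

Definition ch_adjunction : adjunction (ch_functor L) (ch_functor R).
Proof.
refine (@Adjunction (Ch A) (Ch B) (ch_functor L) (ch_functor R)
  ch_unit ch_counit _ _ _ _).
- by move=> K M f n; apply: (unitP adj).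
- by move=> K M f n; apply: (counitP adj).
- by move=> K n; apply: counit_unit.
- by move=> K n; apply: unit_counit.
Defined.

End ComplexAdjunction.

Section Shift.
Variables A B : preadditive.

(** A functor commutes with shifts up to an isomorphism which is the identity
    in each degree; it is not an equality, as the signs in the differentials
    are preserved only up to heq. *)
Definition shift_to (F : functor A B) i (K : complex A) :
  chainMap (complex_map F (shift i K)) (shift i (complex_map F K)).
Proof.
refine (@ChainMap B (complex_map F (shift i K)) (shift i (complex_map F K))
  (fun n => hid (F (K (n + i)))) _) => m n /=.
by rewrite hcomp1r hcomp1l fmap_hsign.
Defined.

Definition shift_from (F : functor A B) i (K : complex A) :
  chainMap (shift i (complex_map F K)) (complex_map F (shift i K)).
Proof.
refine (@ChainMap B (shift i (complex_map F K)) (complex_map F (shift i K))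
  (fun n => hid (F (K (n + i)))) _) => m n /=.
by rewrite hcomp1r hcomp1l fmap_hsign.
Defined.

Lemma shift_fromK (F : functor A B) i (K : complex A) :
  @heq (Ch B) _ _ (chain_comp (shift_to F i K) (shift_from F i K))
    (chain_id _).
Proof. by move=> n /=; rewrite hcomp1l. Qed.

End Shift.

(** * Passing to localizations *)

Section Localization.
Variables (C : preadditive) (W : forall x y : C, hom x y -> Prop).

Definition loc_functor : functor C (localization W).
Proof.
refine (@Functor C (localization W) id (fun x y f => locOf W f) _ _ _ _).
- by move=> x y f g e; apply: leOf.
- by move=> x; apply: leRefl.
- by move=> x y z g f; apply: leOfComp.
- by move=> x y f g; apply: leOfAdd.
Defined.

(** Naturality extends from C to its localization because a morphism and its
    inverse are exchanged in the naturality square. *)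
Lemma loc_natural (E : preadditive) (F G : functor (localization W) E)
    (eta : forall x : C, hom (F x) (G x)) :
  (forall (x y : C) (f : hom x y),
     eta y \oh fmap F (fmap loc_functor f)
       ==h fmap G (fmap loc_functor f) \oh eta x) ->
  natural (F := F) (G := G) eta.
Proof.
move=> etaP x y f; elim: {x y} f =>
  [x y f|x y w Ww|x y z g IHg f IHf|x y f IHf g IHg|x y f IHf].
- exact: etaP.
- pose w' : @hom (localization W) y x := locInv Ww.
  have e1 : fmap F (fmap loc_functor w) \oh fmap F w' ==h hid (F y).
    by rewrite -fmapM -fmap1; apply: fmap_eq; apply: leInvr.
  have e2 : fmap G w' \oh fmap G (fmap loc_functor w) ==h hid (G x).
    by rewrite -fmapM -fmap1; apply: fmap_eq; apply: leInvl.
  rewrite -(hcomp1l (eta x \oh _)) -e2 -!hcompA (hcompA _ (eta x)) -etaP.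
  by rewrite -hcompA e1 hcomp1r.
- rewrite -[locComp g f]/((g : @hom (localization W) y z)
                            \oh (f : @hom (localization W) x y)).
  by rewrite !fmapM hcompA IHg -hcompA IHf hcompA.
- rewrite -[locAdd f g]/((f : @hom (localization W) x y)
                           +h (g : @hom (localization W) x y)).
  by rewrite !fmapD hcompDl hcompDr IHf IHg.
- rewrite -[locOpp f]/(hopp (f : @hom (localization W) x y)).
  by rewrite !fmapN hcompNl hcompNr IHf.
Qed.

End Localization.

Section LocalizedFunctor.
Variables (C : preadditive) (W : forall x y : C, hom x y -> Prop).
Variables (C' : preadditive) (W' : forall x y : C', hom x y -> Prop).
Variables (F : functor C C').
Hypothesis FW : forall (x y : C) (w : hom x y), W w -> W' (fmap F w).

Fixpoint loc_fmap (x y : C) (f : locHom W x y) : locHom W' (F x) (F y) :=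
  match f with
  | locOf x y f => locOf W' (fmap F f)
  | locInv x y w Ww => locInv (FW Ww)
  | locComp x y z g f => locComp (loc_fmap g) (loc_fmap f)
  | locAdd x y f g => locAdd (loc_fmap f) (loc_fmap g)
  | locOpp x y f => locOpp (loc_fmap f)
  end.

Lemma loc_fmap_eq (x y : C) (f g : locHom W x y) :
  locEq f g -> locEq (loc_fmap f) (loc_fmap g).
Proof.
elim=> //= {x y f g}; try by constructor.
- by move=> x y f g h _ e _; apply: leTrans e.
- move=> x y f; apply: leTrans (leComp1l _).
  by apply: leComp (leRefl _); apply: leOf; apply: fmap1.
- move=> x y f; apply: leTrans (leComp1r _).
  by apply: leComp (leRefl _) _; apply: leOf; apply: fmap1.
- move=> x y f; apply: leTrans (leAdd0 _).
  by apply: leAdd (leRefl _); apply: leOf; apply: fmap0.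
- move=> x y f; apply: leTrans (leAddN _) _.
  by apply: leOf; apply: heq_sym; apply: fmap0.
- by move=> x y f g e; apply: leOf; apply: fmap_eq.
- by move=> x y z g f; apply: leTrans (leOfComp _ _ _); apply: leOf; apply: fmapM.
- by move=> x y f g; apply: leTrans (leOfAdd _ _ _); apply: leOf; apply: fmapD.
- move=> x y w Ww; apply: leTrans (leInvl _) _.
  by apply: leOf; apply: heq_sym; apply: fmap1.
- move=> x y w Ww; apply: leTrans (leInvr _) _.
  by apply: leOf; apply: heq_sym; apply: fmap1.
Qed.

Definition localized : functor (localization W) (localization W').
Proof.
refine (@Functor (localization W) (localization W') F loc_fmap _ _ _ _).
- exact: loc_fmap_eq.
- by move=> x; apply: leOf; apply: fmap1.
- by move=> x y z g f; apply: leRefl.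
- by move=> x y f g; apply: leRefl.
Defined.

End LocalizedFunctor.

Section LocalizedAdjunction.
Variables (C : preadditive) (W : forall x y : C, hom x y -> Prop).
Variables (C' : preadditive) (W' : forall x y : C', hom x y -> Prop).
Variables (L : functor C' C) (R : functor C C') (adj : adjunction L R).
Hypothesis LW : forall (x y : C') (w : hom x y), W' w -> W (fmap L w).
Hypothesis RW : forall (x y : C) (w : hom x y), W w -> W' (fmap R w).

Definition localized_adjunction : adjunction (localized LW) (localized RW).
Proof.
refine (@Adjunction _ _ (localized LW) (localized RW)
  (fun x => fmap (loc_functor W') (unit adj x))
  (fun x => fmap (loc_functor W) (counit adj x)) _ _ _ _).
- apply: loc_natural => x y f /=.
  apply: leTrans (leSym (leOfComp _ _ _)) _.
  by apply: leTrans (leOfComp _ _ _); apply: leOf; apply: (unitP adj).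
- apply: loc_natural => x y f /=.
  apply: leTrans (leSym (leOfComp _ _ _)) _.
  by apply: leTrans (leOfComp _ _ _); apply: leOf; apply: (counitP adj).
- move=> x; apply: leTrans (leSym (leOfComp _ _ _)) _.
  by apply: leOf; apply: counit_unit.
- move=> x; apply: leTrans (leSym (leOfComp _ _ _)) _.
  by apply: leOf; apply: unit_counit.
Defined.

End LocalizedAdjunction.

(** * Distinguished open subsets *)

Lemma opens_eq (T : topologicalType) (U V : opens T) :
  U `<=` V -> V `<=` U -> U = V.
Proof.
case: U V => [U oU] [V oV] /= UV VU.
have e : U = V by apply/seteqP.
by case: V / e oV {UV VU} => oV; rewrite (Prop_irrelevance oU oV).
Qed.

Definition capO (T : topologicalType) (U V : opens T) : opens T :=
  Opens (openI (osetP U) (osetP V)).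

Section GermUnits.
Variable X : ringedSpace.
Implicit Types (U V W : opens X) (x : X).

Lemma germ_unit_sub U (a : fn U) x : germ_unit a x -> oset U x.
Proof. by case=> V [h [Vx _]]; apply: h. Qed.

Lemma germ_unit_res U V (h : V `<=` U) (a : fn U) x :
  germ_unit (fres h a) x <-> oset V x /\ germ_unit a x.
Proof.
split=> [ax|[Vx [W [WU [Wx [b ba]]]]]].
  split; first exact: germ_unit_sub ax.
  case: ax => W [WV [Wx [b ba]]]; exists W, (subset_trans WV h); split=> //.
  by exists b; rewrite -ba (fres_comp h WV (subset_trans WV h)).
have WV' : capO W V `<=` W by apply: subIsetl.
have WV : capO W V `<=` V by apply: subIsetr.
exists (capO W V), WV; split=> //; exists (fres WV' b).
rewrite (fres_comp h WV (subset_trans WV' WU)).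
by rewrite -(fres_comp WU WV') -rmorphM ba rmorph1.
Qed.

Lemma germ_unit1 U x : oset U x -> germ_unit (1 : fn U) x.
Proof.
move=> Ux; exists U, (@subset_refl _ U); split=> //.
by exists 1; rewrite rmorph1 mulr1.
Qed.

Lemma germ_unitM U (a b : fn U) x :
  germ_unit (a * b) x <-> germ_unit a x /\ germ_unit b x.
Proof.
split=> [[V [h [Vx [c cab]]]]|].
  split; exists V, h; split=> //; [exists (c * fres h b) | exists (c * fres h a)].
    by rewrite -mulrA [fres h b * _]mulrC -rmorphM.
  by rewrite -mulrA -rmorphM.
case=> [[V [VU [Vx [c ca]]]] [W [WU [Wx [d db]]]]].
have iV : capO V W `<=` V by apply: subIsetl.
have iW : capO V W `<=` W by apply: subIsetr.
have i := subset_trans iV VU.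
exists (capO V W), i; split=> //; exists (fres iV c * fres iW d).
rewrite rmorphM mulrACA -{1}(fres_comp VU iV i) -(fres_comp WU iW i).
by rewrite -!rmorphM ca db !rmorph1 mulr1.
Qed.

Lemma germ_unitX U (a : fn U) n x : germ_unit a x -> germ_unit (a ^+ n) x.
Proof.
move=> ax; elim: n => [|n IH]; first exact: germ_unit1 (germ_unit_sub ax).
by rewrite exprS; apply/germ_unitM.
Qed.

Lemma unit_germ_unit U (a b : fn U) x : oset U x -> b * a = 1 -> germ_unit a x.
Proof.
move=> Ux /(congr1 (fun c => germ_unit c x)) e.
by have := germ_unit1 Ux; rewrite -e => /germ_unitM[].
Qed.

End GermUnits.

Lemma scaler_bij (A : comPzRingType) (M : lmodType A) (a b : A) :
  b * a = 1 -> bijective ( *:%R a : M -> M).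
Proof.
by move=> ba; exists ( *:%R b) => x; rewrite scalerA ?ba ?[a * b]mulrC ?ba scale1r.
Qed.

Section Scheme.
Variables (k : fieldType) (X : scheme k).
Implicit Types (U V W : opens X) (x : X) (F : qcohSheaf X).

(** For affine U: the restriction of F to U is the sheaf attached to the module
    F(U). *)
Definition is_tilde F U : Prop := forall a : fn U,
  is_localization ( *:%R a) ( *:%R (fres (@nonvanishing_sub X U a) a))
    (mres F (@nonvanishing_sub X U a)).

(** Allowing D to be only provably equal to D(a) spares transports when the
    same open set is distinguished in several ways. *)
Lemma is_tilde_eq F U (a : fn U) (D : opens X) (h : D `<=` U) :
  is_tilde F U -> D = nonvanishing a ->
  is_localization ( *:%R a) ( *:%R (fres h a)) (mres F h).
Proof.
move=> tF e; subst D.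
by rewrite (Prop_irrelevance h (@nonvanishing_sub X U a)).
Qed.

(** Seen as a sheaf of modules, so that what is proved on localizations of
    modules applies to the last condition defining affine open sets. *)
Definition structure_sheaf : qcohSheaf X.
Proof.
refine (@QCohSheaf X (fun U => (fn U)^o) (fun U V h => fres h) _ _ _ _ (@fn_sheaf X) _).
- by move=> *; rewrite rmorphD.
- by move=> U V h a s; rewrite /= [LHS]rmorphM.
- exact: fres_id.
- exact: fres_comp.
- by move=> x; have [U [Ux [p1 p2 p3 p4]]] := locally_affine x; exists U.
Defined.

Lemma affine_tilde U : affine U -> is_tilde structure_sheaf U.
Proof. by case. Qed.

Lemma affine_unit U (a : fn U) (D : opens X) (h : D `<=` U) :
  affine U -> D = nonvanishing a -> exists b : fn D, b * fres h a = 1.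
Proof.
move=> /affine_tilde /is_tilde_eq /[apply] - /(_ h) [[f _ fK] _ _].
by exists (f 1); rewrite mulrC; apply: (fK 1).
Qed.

Lemma affine_frac U (a : fn U) (D : opens X) (h : D `<=` U) (b : fn D) :
  affine U -> D = nonvanishing a -> exists (c : fn U) n, fres h a ^+ n * b = fres h c.
Proof.
move=> /affine_tilde /is_tilde_eq /[apply] - /(_ h) [_ /(_ b) [c [n e]] _].
by exists c, n; rewrite -[RHS]e iter_scale.
Qed.

(** On D(a), where a is invertible, the germ of b = c / a^n is invertible exactly
    where that of c is. *)
Lemma nonvanishing_frac U (a : fn U) (D : opens X) (h : D `<=` U)
    (b : fn D) (c : fn U) n :
  D = nonvanishing a -> fres h a ^+ n * b = fres h c ->
  nonvanishing b = nonvanishing (a * c).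
Proof.
move=> eD e; have inD x : oset D x <-> germ_unit a x by rewrite eD.
apply: opens_eq => x /=.
  move=> bx; have Dx := germ_unit_sub bx; have ax := (inD x).1 Dx.
  apply/germ_unitM; split=> //.
  have : germ_unit (fres h c) x.
    by rewrite -e; apply/germ_unitM; split=> //; apply/germ_unitX/germ_unit_res.
  by case/germ_unit_res.
case/germ_unitM => ax cx; have Dx := (inD x).2 ax.
have : germ_unit (fres h c) x by apply/germ_unit_res.
by rewrite -e => /germ_unitM[].
Qed.

(** For b = c / a^n on D(a), the open subset D(b) is D(a c), over which the
    sections of F are the fractions with denominators powers of a c; as a is
    already invertible on D(a), powers of b do as well. *)
Lemma is_tilde_distinguished F U (a : fn U) (D : opens X) :
  affine U -> is_tilde F U -> D = nonvanishing a -> is_tilde F D.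
Proof.
move=> affU tF eD b.
have h : D `<=` U by rewrite eD; apply: nonvanishing_sub.
have [c [n e]] := affine_frac h b affU eD.
have eb := nonvanishing_frac eD e.
set i := @nonvanishing_sub X D b; have j := subset_trans i h.
have [u ua] := affine_unit h affU eD.
have [w wac] := affine_unit j affU eb.
have [_ surj ker] := is_tilde_eq j tF eb.
have [_ surjD kerD] := is_tilde_eq h tF eD.
have resU (d : fn U) : fres j d = fres i (fres h d) by rewrite (fres_comp h i j).
have uaX m : u ^+ m * fres h a ^+ m = 1 by rewrite -exprMn ua expr1n.
have acX m : fres h (a * c) ^+ m = fres h a ^+ (m + n * m) * b ^+ m.
  by rewrite rmorphM -e mulrA -exprS exprMn -exprM mulSn.
split.
- apply: (@scaler_bij _ _ _ (w * fres j (a ^+ n.+1))).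
  rewrite -wac -mulrA; congr (w * _).
  have {}e : fres h (a ^+ n.+1) * b = fres h (a * c).
    by rewrite exprS !rmorphM rmorphXn -mulrA e.
  by rewrite !resU -rmorphM e.
- move=> y; have [z [m]] := surj y; rewrite iter_scale => zP.
  exists (u ^+ (m + n * m)%N *: mres F h z), m.
  rewrite iter_scale mresZ (mres_comp h i j) -zP scalerA.
  have -> : fres j (a * c) ^+ m = fres i (fres h a ^+ (m + n * m) * b ^+ m).
    by rewrite resU -rmorphXn acX.
  by rewrite -[in RHS]rmorphM mulrA uaX mul1r rmorphXn.
- move=> y y0; have [z [m]] := surjD y; rewrite iter_scale => zP.
  have : mres F j z = 0 by rewrite -(mres_comp h i j) -zP mresZ y0 scaler0.
  case/ker=> p; rewrite iter_scale => /(congr1 (mres F h)).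
  rewrite mresZ -zP scalerA rmorphXn acX => acz.
  exists p; rewrite iter_scale.
  have z0 : mres F h (0 : F U) = 0 by rewrite -(scale0r 0) mresZ rmorph0 scale0r.
  rewrite z0 in acz.
  have := congr1 ( *:%R (u ^+ (p + n * p + m)%N)) acz; rewrite scaler0 scalerA => <-.
  congr (_ *: y); rewrite -mulrA [b ^+ p * _]mulrC [X in _ * X]mulrA -exprD.
  by rewrite mulrA uaX mul1r.
Qed.

(** The primes of O(U)[1/a] are the primes of O(U) not containing a.  Sections
    over D(a) being fractions c / a^n, all conditions on germs can be tested on
    the numerators c. *)
Lemma affine_distinguished U (a : fn U) (D : opens X) :
  affine U -> D = nonvanishing a -> affine D.
Proof.
move=> affU eD.
have tD := is_tilde_distinguished affU (affine_tilde affU) eD.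
have h : D `<=` U by rewrite eD; apply: nonvanishing_sub.
have inD x : oset D x <-> germ_unit a x by rewrite eD.
have [u ua] := affine_unit h affU eD.
have uaX m : u ^+ m * fres h a ^+ m = 1 by rewrite -exprMn ua expr1n.
have frac (b : fn D) : exists (c : fn U) (v : fn D) n,
    b = v * fres h c /\ v * fres h a ^+ n = 1.
  have [c [n e]] := affine_frac h b affU eD.
  by exists c, (u ^+ n), n; rewrite -e mulrA uaX mul1r.
case: (affU) => prU ptU baU _.
split=> [x Dx|P [P0 PD PM P1 PP]|V VD x Vx|]; last exact: tD.
- have [p0 pD pM p1 pP] := prU x (h x Dx).
  have ax n : germ_unit (fres h a ^+ n) x.
    by apply: germ_unitX; apply/germ_unit_res; split=> //; apply/inD.
  split=> /=.
  + by rewrite -(rmorph0 (fres h)) => /germ_unit_res[_]; apply: p0.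
  + move=> b b' bx b'x.
    have [c [n e]] := affine_frac h b affU eD.
    have [c' [n' e']] := affine_frac h b' affU eD.
    have cx : ~ germ_unit (a ^+ n' * c) x.
      case/germ_unitM=> _ cx; apply: bx.
      have : germ_unit (fres h c) x by apply/germ_unit_res.
      by rewrite -e => /germ_unitM[].
    have c'x : ~ germ_unit (a ^+ n * c') x.
      case/germ_unitM=> _ cx'; apply: b'x.
      have : germ_unit (fres h c') x by apply/germ_unit_res.
      by rewrite -e' => /germ_unitM[].
    move=> bbx; apply: (pD _ _ cx c'x).
    have : germ_unit (fres h a ^+ (n' + n) * (b + b')) x by apply/germ_unitM.
    suff -> : fres h a ^+ (n' + n) * (b + b') = fres h (a ^+ n' * c + a ^+ n * c').
      by case/germ_unit_res.
    by rewrite rmorphD !rmorphM !rmorphXn -e -e' mulrDr !mulrA -!exprD [(n + n')%N]addnC.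
  + by move=> b b' b'x /germ_unitM[_ /b'x].
  + by move=> x1; apply: x1; apply: germ_unit1.
  + move=> b b' bbx; apply: contrapT => /not_orP[/contrapT bx /contrapT b'x].
    by apply: bbx; apply/germ_unitM.
- have PMr b b' : P b -> P (b * b') by move=> Pb; rewrite mulrC; apply: PM.
  have Punit b v : v * b = 1 -> ~ P b by move=> vb Pb; apply: P1; rewrite -vb; apply: PM.
  have frP b c v n : b = v * fres h c -> v * fres h a ^+ n = 1 -> P b <-> P (fres h c).
    move=> -> va; split=> [/PP[]//|]; last exact: PM.
    by rewrite mulrC in va => /(Punit _ _ va).
  have frx x b c v n : oset D x -> b = v * fres h c -> v * fres h a ^+ n = 1 ->
      germ_unit b x <-> germ_unit c x.
    move=> Dx -> va; rewrite mulrC in va; have vx := unit_germ_unit Dx va.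
    split=> [/germ_unitM[_ /germ_unit_res[]]//|cx].
    by apply/germ_unitM; split=> //; apply/germ_unit_res.
  have prQ : prime_ideal [set c : fn U | P (fres h c)].
    split=> /= [|c d|c d||c d]; rewrite ?rmorph0 ?rmorphD ?rmorphM ?rmorph1 //; auto.
  have toU x : oset D x -> P = [set b | ~ germ_unit b x] ->
      [set c : fn U | P (fres h c)] = [set c | ~ germ_unit c x].
    move=> Dx ->; apply/seteqP; split=> c /= cx cx'; apply: cx.
      by apply/germ_unit_res.
    by case/germ_unit_res: cx'.
  have [x [[Ux ex] x_uniq]] := ptU _ prQ.
  have Dx : oset D x.
    apply/inD; apply: contrapT => ax.
    have : [set c : fn U | P (fres h c)] a by rewrite ex.
    by apply: Punit ua.
  exists x; split; last first.
    by move=> y [Dy ey]; apply: x_uniq; split; [exact: (h y Dy) | exact: toU].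
  split=> //; apply/seteqP; split=> b /=; have [c [v [n [eb va]]]] := frac b.
    move=> /(frP _ _ _ _ eb va) Pc /(frx _ _ _ _ _ Dx eb va).
    by have : [set c : fn U | P (fres h c)] c by []; rewrite ex.
  move=> bx; apply/(frP _ _ _ _ eb va).
  have : [set c : fn U | ~ germ_unit c x] c by move=> cx; apply/bx/(frx _ _ _ _ _ Dx eb va).
  by rewrite -ex.
- have [c [cx cV]] := baU V (subset_trans VD h) x Vx.
  exists (fres h c); split; first by apply/germ_unit_res; split=> //; apply: VD.
  by move=> y /germ_unit_res[_]; apply: cV.
Qed.

(** Shrink to D(f) in U, then to D(g) in V; over D(f), the function g is a
    fraction, so that D(g) is distinguished in U as well. *)
Lemma common_distinguished U V x :
  affine U -> affine V -> oset U x -> oset V x ->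
  exists (a : fn U) (b : fn V),
    oset (nonvanishing a) x /\ nonvanishing a = nonvanishing b.
Proof.
move=> affU affV Ux Vx.
case: (affU) => _ _ baU _; case: (affV) => _ _ baV _.
have [f [fx fUV]] := baU (capO U V) (@subIsetl _ _ _) x (conj Ux Vx).
have fU : nonvanishing f `<=` U by apply: nonvanishing_sub.
have fV : nonvanishing f `<=` V by move=> y /fUV[].
have [g [gx gf]] := baV (nonvanishing f) fV x fx.
have [c [n e]] := affine_frac fU (fres fV g) affU (erefl _).
have e' := nonvanishing_frac (erefl _) e.
exists (f * c), g; rewrite -e'; split; first by apply/germ_unit_res.
apply: opens_eq => y /=; first by case/germ_unit_res.
by move=> gy; apply/germ_unit_res; split=> //; apply: gf.
Qed.

(** By induction on r: a distinguished open subset common to the neighbourhood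
    found for the previous sheaves and to one adapted to the next sheaf is
    adapted to all of them, since both properties pass to distinguished open
    subsets. *)
Lemma common_tilde (I : eqType) (F : I -> qcohSheaf X) (r : seq I) x :
  exists U, [/\ oset U x, affine U & forall i, i \in r -> is_tilde (F i) U].
Proof.
elim: r => [|i r [U [Ux affU tU]]].
  by have [U [Ux affU]] := locally_affine x; exists U.
have [V [Vx affV tV]] := quasi_coherent (F i) x.
have [a [b [ax ab]]] := common_distinguished affU affV Ux Vx.
exists (nonvanishing a); split=> //; first exact: affine_distinguished affU _.
move=> j; rewrite inE => /orP[/eqP->|jr].
  exact: is_tilde_distinguished affV tV ab.
exact: is_tilde_distinguished affU (tU j jr) _.
Qed.

End Scheme.

(** * Translates of open subsets *)

Lemma is_localization_iso (M N M' N' : zmodType) (fM : M -> M) (fN : N -> N)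
    (phi : M -> N) (fM' : M' -> M') (fN' : N' -> N') (phi' : M' -> N')
    (u : M -> M') (v : N -> N') :
  bijective u -> bijective v -> u 0 = 0 -> v 0 = 0 ->
  (forall x, u (fM x) = fM' (u x)) -> (forall y, v (fN y) = fN' (v y)) ->
  (forall x, v (phi x) = phi' (u x)) ->
  is_localization fM' fN' phi' -> is_localization fM fN phi.
Proof.
move=> [u' uK u'K] [v' vK v'K] u0 v0 uM vN uv [[i iK Ki] surj ker].
have uMi e x : u (iter e fM x) = iter e fM' (u x) by elim: e => //= e IH; rewrite uM IH.
have vNi e x : v (iter e fN x) = iter e fN' (v x) by elim: e => //= e IH; rewrite vN IH.
split.
- exists (v' \o i \o v) => y /=; first by rewrite vN iK vK.
  by apply: (can_inj vK); rewrite vN v'K Ki.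
- move=> y; have [x [e xP]] := surj (v y); exists (u' x), e.
  by apply: (can_inj vK); rewrite vNi xP uv u'K.
- move=> x x0; have [|e eP] := ker (u x); first by rewrite -uv x0 v0.
  by exists e; apply: (can_inj uK); rewrite uMi eP u0.
Qed.

Lemma prime_ideal_preim (A B : comPzRingType) (f : {rmorphism A -> B}) (P : set B) :
  prime_ideal P -> prime_ideal [set a | P (f a)].
Proof.
case=> P0 PD PM P1 PP; split=> /=; rewrite ?rmorph0 ?rmorph1 // => a b.
- by rewrite rmorphD; apply: PD.
- by rewrite rmorphM; apply: PM.
- by rewrite rmorphM; apply: PP.
Qed.

Lemma prime_ideal_im (A B : comPzRingType) (f : {rmorphism A -> B}) (P : set A) :
  bijective f -> prime_ideal P -> prime_ideal [set b | exists2 a, P a & b = f a].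
Proof.
move=> [f' fK f'K] [P0 PD PM P1 PP].
have im b : [set b | exists2 a, P a & b = f a] b <-> P (f' b).
  by split=> [[a Pa ->]|Pb]; [rewrite fK | exists (f' b)].
have f'M b c : f' (b * c) = f' b * f' c by apply: (can_inj fK); rewrite rmorphM !f'K.
have f'D b c : f' (b + c) = f' b + f' c by apply: (can_inj fK); rewrite rmorphD !f'K.
split.
- by exists 0; rewrite ?rmorph0.
- by move=> b c /im Pb /im Pc; apply/im; rewrite f'D; apply: PD.
- by move=> b c /im Pc; apply/im; rewrite f'M; apply: PM.
- by move/im; rewrite -(rmorph1 f) fK.
- by move=> b c /im; rewrite f'M => /PP[] ?; [left | right]; apply/im.
Qed.

Section Translate.
Variables (k : fieldType) (X : scheme k) (gT : finGroupType) (s : gaction X gT).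
Implicit Types (U V W : opens X) (g h : gT).

Lemma translateS g U V : V `<=` U -> translate s g V `<=` translate s g U.
Proof. by move=> h x; apply: h. Qed.

Lemma translateM g h U :
  translate s (g * h)%g U = translate s g (translate s h U).
Proof. by apply: opens_eq => x /=; rewrite /translate /= invMg actM. Qed.

Lemma translate1 U : translate s 1%g U = U.
Proof. by apply: opens_eq => x /=; rewrite invg1 act1. Qed.

Lemma sub_translateM g h U :
  translate s g (translate s h U) `<=` translate s (g * h)%g U.
Proof. by rewrite translateM. Qed.

Lemma translate1_sub U : translate s 1%g U `<=` U.
Proof. by rewrite translate1. Qed.

Lemma sub_translate1 U : U `<=` translate s 1%g U.
Proof. by rewrite translate1. Qed.

Lemma sub_translateVK g U : U `<=` translate s g^-1 (translate s g U).
Proof. by rewrite -translateM mulVg translate1. Qed.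

Lemma translate_fn_res g U V (h : V `<=` U)
    (h' : translate s g V `<=` translate s g U) (a : fn U) :
  translate_fn s g (fres h a) = fres h' (translate_fn s g a).
Proof. exact: comorph_res. Qed.

Lemma translate_fn1 U V (e : V `<=` translate s 1%g U) (e' : V `<=` U) (a : fn U) :
  fres e (translate_fn s 1%g a) = fres e' a.
Proof.
rewrite /translate_fn /translate in e *; move: (1^-1)%g (invg1 gT) e => g -> e.
exact: act1_fn.
Qed.

Lemma translate_fnM g h U V (e : V `<=` translate s (g * h)%g U)
    (e' : V `<=` translate s g (translate s h U)) (a : fn U) :
  fres e (translate_fn s (g * h)%g a)
    = fres e' (translate_fn s g (translate_fn s h a)).
Proof.
rewrite /translate_fn /translate in e e' *.
move: ((g * h)^-1)%g (invMg g h) e => f -> e.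
exact: actM_fn.
Qed.

Lemma translate_fnVM g h U V (gh : (g * h = 1)%g)
    (e : V `<=` translate s g (translate s h U)) (e' : V `<=` U) (a : fn U) :
  fres e (translate_fn s g (translate_fn s h a)) = fres e' a.
Proof.
have e1 : V `<=` translate s (g * h)%g U by rewrite translateM.
rewrite -(translate_fnM e1); move: (g * h)%g gh e1 => f -> e1.
exact: translate_fn1.
Qed.

Lemma germ_unit_translate g U (a : fn U) x :
  germ_unit (translate_fn s g a) x <-> germ_unit a (s g^-1%g x).
Proof.
split=> [|[V [h [Vx [b ba]]]]]; first exact: comorph_local.
exists (translate s g V), (translateS h); split=> //.
exists (translate_fn s g b).
by rewrite -(translate_fn_res h) /translate_fn -rmorphM ba rmorph1.
Qed.

Lemma nonvanishing_translate g U (a : fn U) :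
  nonvanishing (translate_fn s g a) = translate s g (nonvanishing a).
Proof. by apply: opens_eq => x /germ_unit_translate. Qed.

Lemma translate_fn_bij g U : bijective (@translate_fn _ _ _ s g U).
Proof.
exists (fun b => fres (@sub_translateVK g U) (translate_fn s g^-1%g b)) => a.
  by rewrite (translate_fnVM (mulVg g) _ (@subset_refl _ U)) fres_id.
rewrite (translate_fn_res _ (translateS (@sub_translateVK g U))).
by rewrite (translate_fnVM (mulgV g) _ (@subset_refl _ _)) fres_id.
Qed.

Lemma actKV g x : s g (s g^-1%g x) = x.
Proof. by rewrite -actM mulgV act1. Qed.

Lemma actVK g x : s g^-1%g (s g x) = x.
Proof. by rewrite -actM mulVg act1. Qed.

(** The automorphism g and the isomorphism O(U) -> O(gU) identify the points and
    functions of U with those of gU, compatibly with germs and with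
    distinguished open subsets; this carries over each of the conditions. *)
Lemma affine_translate g U : affine (translate s g U) -> affine U.
Proof.
move=> affgU; case: (affgU) => prU ptU baU _.
have gbij := translate_fn_bij g U.
have [gi giK gKi] := gbij.
have germE (a : fn U) x : germ_unit (translate_fn s g a) (s g x) <-> germ_unit a x.
  by split=> [/germ_unit_translate|ax]; last apply/germ_unit_translate; rewrite actVK.
split.
- move=> x Ux; have gx : oset (translate s g U) (s g x) by rewrite /translate /= actVK.
  have -> : [set a : fn U | ~ germ_unit a x]
      = [set a | [set b | ~ germ_unit b (s g x)] (comorph (s g^-1%g) U a)].
    by apply/seteqP; split=> a /= ax /germE.
  exact: prime_ideal_preim (prU _ gx).
- move=> P prP.
  have [y [[Uy ey] y_uniq]] := ptU _ (@prime_ideal_im _ _ (comorph (s g^-1%g) U) _ gbij prP).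
  have PE a : P a <-> ~ germ_unit (translate_fn s g a) y.
    have eya := congr1 (fun Q : set _ => Q (translate_fn s g a)) ey.
    rewrite /= in eya; rewrite -eya.
    by split=> [Pa|[b Pb /(bij_inj gbij) ->//]]; exists a.
  exists (s g^-1%g y); split.
    split=> //; apply/seteqP; split=> a /=; first by move/PE => n /germ_unit_translate.
    by move=> n; apply/PE => /germ_unit_translate.
  move=> x [Ux ePx]; rewrite -(actVK g x); congr (s g^-1%g _); apply: y_uniq.
  split; first by rewrite /translate /= actVK.
  apply/seteqP; split=> b /=; first by case=> a; rewrite ePx => /= n -> /germE.
  move=> n; exists (gi b); last by rewrite -[LHS]gKi.
  by rewrite ePx /= => /germE; rewrite gKi.
- move=> V VU x Vx; have [||b [bx bV]] := baU (translate s g V) _ (s g x).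
  + exact: translateS.
  + by rewrite /translate /= actVK.
  exists (gi b); split; first by apply/germE; rewrite gKi.
  move=> y /germE; rewrite gKi => /bV; by rewrite /translate /= actVK.
- move=> a; set D := nonvanishing a; set i := @nonvanishing_sub X U a.
  have := is_tilde_eq (translateS i) (affine_tilde affgU) (esym (nonvanishing_translate g a)).
  apply: (is_localization_iso (u := @translate_fn _ _ _ s g U) (v := @translate_fn _ _ _ s g D)).
  + exact: gbij.
  + exact: translate_fn_bij.
  + exact: rmorph0.
  + exact: rmorph0.
  + by move=> b; rewrite /translate_fn rmorphM.
  + by move=> b; rewrite -(translate_fn_res i) /translate_fn rmorphM.
  + by move=> b; rewrite (translate_fn_res i (translateS i)).
Qed.

End Translate.

(** * Inverse images and finite products of quasi-coherent sheaves *)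

Lemma dfunP (I : Type) (M : I -> Type) (x y : forall i, M i) :
  (forall i, x i = y i) -> x = y.
Proof. exact: functional_extensionality_dep. Qed.

Lemma dfun_choice (I : Type) (M : I -> Type) (P : forall i, M i -> Prop) :
  (forall i, exists x, P i x) -> exists f : forall i, M i, forall i, P i (f i).
Proof.
by move=> ex; exists (fun i => projT1 (cid (ex i))) => i; apply: projT2 (cid (ex i)).
Qed.

Section Pull.
Variables (k : fieldType) (X : scheme k) (gT : finGroupType) (s : gaction X gT).
Variables (g : gT) (F : qcohSheaf X).
Implicit Types U V : opens X.

Definition pull_sec U : Type := F (translate s g U).

HB.instance Definition _ U := GRing.Zmodule.copy (pull_sec U) (F (translate s g U)).

Definition pull_scale U (a : fn U) (x : pull_sec U) : pull_sec U :=
  translate_fn s g a *: (x : F (translate s g U)).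

Lemma pull_scaleA U (a b : fn U) (x : pull_sec U) :
  pull_scale a (pull_scale b x) = pull_scale (a * b) x.
Proof. by rewrite /pull_scale scalerA /translate_fn rmorphM. Qed.

Lemma pull_scale1 U : left_id 1 (@pull_scale U).
Proof. by move=> x; rewrite /pull_scale /translate_fn rmorph1 scale1r. Qed.

Lemma pull_scaleDr U : right_distributive (@pull_scale U) +%R.
Proof. by move=> a x y; rewrite /pull_scale scalerDr. Qed.

Lemma pull_scaleDl U (x : pull_sec U) : {morph (@pull_scale U)^~ x : a b / a + b}.
Proof. by move=> a b; rewrite /pull_scale /translate_fn rmorphD scalerDl. Qed.

HB.instance Definition _ U := GRing.Zmodule_isLmodule.Build (fn U) (pull_sec U)
  (@pull_scaleA U) (@pull_scale1 U) (@pull_scaleDr U) (@pull_scaleDl U).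

Definition pull_res U V (h : V `<=` U) : pull_sec U -> pull_sec V :=
  mres F (translateS (s := s) (g := g) h).

Lemma pull_sheaf_condition : sheaf_condition pull_res.
Proof.
move=> I V U VU cov x compat.
have gVU i := translateS (s := s) (g := g) (VU i).
have [||t [tP t_uniq]] := sec_sheaf gVU _ (s := x).
- by move=> p /= /cov[i _ Vip]; exists i.
- move=> i j W Wi Wj.
  (* Every open subset is a translate, so compat applies to all of them. *)
  have WE : W = translate s g (translate s g^-1%g W) by rewrite -translateM mulgV translate1.
  rewrite WE in Wi Wj *.
  have Wi' : translate s g^-1%g W `<=` V i.
    move=> p Wp; rewrite -(actVK s g p); apply: Wi; rewrite -WE.
    by rewrite /translate /= invgK in Wp.
  have Wj' : translate s g^-1%g W `<=` V j.
    move=> p Wp; rewrite -(actVK s g p); apply: Wj; rewrite -WE.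
    by rewrite /translate /= invgK in Wp.
  have := compat i j _ Wi' Wj'; rewrite /pull_res.
  by rewrite (Prop_irrelevance (translateS Wi') Wi) (Prop_irrelevance (translateS Wj') Wj).
exists t; split=> [i|t' t'P]; last first.
  by apply: t_uniq => i; rewrite -t'P /pull_res; congr (mres F _ t'); apply: Prop_irrelevance.
by rewrite -tP /pull_res; congr (mres F _ t); apply: Prop_irrelevance.
Qed.

Lemma pull_tilde U : is_tilde F (translate s g U) -> forall a : fn U,
  is_localization ( *:%R a : pull_sec U -> pull_sec U)
    ( *:%R (fres (@nonvanishing_sub X U a) a) : pull_sec _ -> pull_sec _)
    (pull_res (@nonvanishing_sub X U a)).
Proof.
move=> tF a; set i := @nonvanishing_sub X U a.
have := is_tilde_eq (translateS i) tF (esym (nonvanishing_translate s g a)).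
rewrite -(translate_fn_res i (translateS i)).
by apply.
Qed.

Lemma pull_quasi_coherent (x : X) : exists U : opens X,
  [/\ oset U x, affine U & forall a : fn U,
    is_localization ( *:%R a : pull_sec U -> pull_sec U)
      ( *:%R (fres (@nonvanishing_sub X U a) a) : pull_sec _ -> pull_sec _)
      (pull_res (@nonvanishing_sub X U a))].
Proof.
have [V [Vx affV tV]] := quasi_coherent F (s g x).
have VE : V = translate s g (translate s g^-1%g V) by rewrite -translateM mulgV translate1.
rewrite VE in affV; exists (translate s g^-1%g V); split.
- by rewrite /translate /= invgK.
- exact: affine_translate affV.
- by apply: pull_tilde; rewrite -VE.
Qed.

(** The inverse image g^* F. *)
Definition pull : qcohSheaf X.
Proof.
refine (@QCohSheaf X (fun U => pull_sec U) pull_res _ _ _ _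
  pull_sheaf_condition pull_quasi_coherent).
- by move=> U V h x y; apply: mresD.
- move=> U V h a x; rewrite [LHS](mresZ (translateS h)).
  by rewrite -(translate_fn_res h).
- by move=> U h x; apply: mres_id.
- by move=> U V W VU WV WU x; apply: mres_comp.
Defined.

End Pull.

Section Product.
Variables (k : fieldType) (X : scheme k) (I : finType) (F : I -> qcohSheaf X).
Implicit Types U V : opens X.

Definition prod_sec U : Type := forall i, F i U.

HB.instance Definition _ U := Choice.copy (prod_sec U) (forall i, F i U).

Lemma prod_addA U : associative (fun x y : prod_sec U => (fun i => x i + y i) : prod_sec U).
Proof. by move=> x y z; apply: dfunP => i; rewrite addrA. Qed.

Lemma prod_addC U : commutative (fun x y : prod_sec U => (fun i => x i + y i) : prod_sec U).
Proof. by move=> x y; apply: dfunP => i; rewrite addrC. Qed.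

Lemma prod_add0 U : left_id ((fun i => 0) : prod_sec U)
  (fun x y : prod_sec U => (fun i => x i + y i) : prod_sec U).
Proof. by move=> x; apply: dfunP => i; rewrite add0r. Qed.

Lemma prod_addN U : left_inverse ((fun i => 0) : prod_sec U)
  (fun x : prod_sec U => (fun i => - x i) : prod_sec U)
  (fun x y : prod_sec U => (fun i => x i + y i) : prod_sec U).
Proof. by move=> x; apply: dfunP => i; rewrite addNr. Qed.

HB.instance Definition _ U := GRing.isZmodule.Build (prod_sec U)
  (@prod_addA U) (@prod_addC U) (@prod_add0 U) (@prod_addN U).

Definition prod_scale U (a : fn U) (x : prod_sec U) : prod_sec U :=
  fun i => a *: x i.

Lemma prod_scaleA U (a b : fn U) (x : prod_sec U) :
  prod_scale a (prod_scale b x) = prod_scale (a * b) x.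
Proof. by apply: dfunP => i; rewrite /prod_scale scalerA. Qed.

Lemma prod_scale1 U : left_id 1 (@prod_scale U).
Proof. by move=> x; apply: dfunP => i; rewrite /prod_scale scale1r. Qed.

Lemma prod_scaleDr U : right_distributive (@prod_scale U) +%R.
Proof. by move=> a x y; apply: dfunP => i; rewrite /prod_scale scalerDr. Qed.

Lemma prod_scaleDl U (x : prod_sec U) : {morph (@prod_scale U)^~ x : a b / a + b}.
Proof. by move=> a b; apply: dfunP => i; rewrite /prod_scale scalerDl. Qed.

HB.instance Definition _ U := GRing.Zmodule_isLmodule.Build (fn U) (prod_sec U)
  (@prod_scaleA U) (@prod_scale1 U) (@prod_scaleDr U) (@prod_scaleDl U).

Definition prod_res U V (h : V `<=` U) (x : prod_sec U) : prod_sec V :=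
  fun i => mres (F i) h (x i).

Lemma prod_sheaf_condition : sheaf_condition prod_res.
Proof.
move=> J V U VU cov x compat.
have loc i : exists! t : F i U, forall j, mres (F i) (VU j) t = x j i.
  apply: sec_sheaf => // j j' W Wj Wj'.
  exact: (congr1 (@^~ i) (compat j j' W Wj Wj')).
have [t tP] := dfun_choice loc.
exists t; split=> [j|y yP]; apply: dfunP => i; have [ti ti_uniq] := tP i.
  exact: ti.
by apply: ti_uniq => j; rewrite -yP.
Qed.

Lemma prod_iter U (a : fn U) e (x : prod_sec U) i :
  iter e ( *:%R a) x i = a ^+ e *: x i.
Proof. by rewrite iter_scale. Qed.

Lemma prod_tilde U : (forall i, is_tilde (F i) U) -> forall a : fn U,
  is_localization ( *:%R a : prod_sec U -> prod_sec U)
    ( *:%R (fres (@nonvanishing_sub X U a) a) : prod_sec _ -> prod_sec _)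
    (prod_res (@nonvanishing_sub X U a)).
Proof.
move=> tF a; set h := @nonvanishing_sub X U a; split.
- have /dfun_choice [inv invP] i : exists inv : F i (nonvanishing a) -> F i (nonvanishing a),
      cancel ( *:%R (fres h a)) inv /\ cancel inv ( *:%R (fres h a)).
    by have [[inv ? ?] _ _] := tF i a; exists inv.
  exists (fun x i => inv i (x i)) => x; apply: dfunP => i; have [iK Ki] := invP i.
    exact: iK.
  exact: Ki.
- move=> y.
  have /dfun_choice [z zP] i : exists x, exists e, fres h a ^+ e *: y i = mres (F i) h x.
    by have [_ /(_ (y i)) [x [e eP]] _] := tF i a; exists x, e; rewrite -iter_scale.
  have [e eP] := choice zP.
  (* A common exponent for the finitely many components. *)
  pose N := (\sum_i e i)%N.
  have eN i : (e i <= N)%N by rewrite /N (bigD1 i) //= leq_addr.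
  exists (fun i => a ^+ (N - e i) *: z i), N.
  apply: dfunP => i; rewrite prod_iter /prod_res mresZ rmorphXn -eP.
  by rewrite scalerA -exprD subnK.
- move=> y y0.
  have y0i i : mres (F i) h (y i) = 0 by exact: (congr1 (@^~ i) y0).
  have /choice [e eP] i : exists e, a ^+ e *: y i = 0.
    by have [_ _ /(_ _ (y0i i)) [e eP]] := tF i a; exists e; rewrite -iter_scale.
  pose N := (\sum_i e i)%N.
  have eN i : (e i <= N)%N by rewrite /N (bigD1 i) //= leq_addr.
  exists N; apply: dfunP => i; rewrite prod_iter.
  by rewrite -(subnK (eN i)) exprD -scalerA eP scaler0.
Qed.

Definition product : qcohSheaf X.
Proof.
refine (@QCohSheaf X (fun U => prod_sec U) prod_res _ _ _ _ prod_sheaf_condition _).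
- by move=> U V h x y; apply: dfunP => i; apply: mresD.
- by move=> U V h a x; apply: dfunP => i; apply: mresZ.
- by move=> U h x; apply: dfunP => i; apply: mres_id.
- by move=> U V W VU WV WU x; apply: dfunP => i; apply: mres_comp.
- move=> x; have [U [Ux affU tU]] := common_tilde F (enum I) x.
  by exists U; split=> //; apply: prod_tilde => i; apply: tU; rewrite mem_enum.
Defined.

End Product.

(** * Induced equivariant sheaves *)

Section Induction.
Variables (k : fieldType) (X : scheme k) (gT : finGroupType) (s : gaction X gT).
Implicit Types (U V W : opens X) (g h : gT).

Let G : {group gT} := [set: gT]%G.

Lemma in_full g : g \in G.
Proof. exact: finset.in_setT. Qed.

Lemma mres_trans (F : qcohSheaf X) U V W (VU : V `<=` U) (WV : W `<=` V) (x : F U) :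
  mres F WV (mres F VU x) = mres F (subset_trans WV VU) x.
Proof. exact: mres_comp. Qed.

Lemma mres_irr (F : qcohSheaf X) U V (h h' : V `<=` U) (x : F U) :
  mres F h x = mres F h' x.
Proof. by rewrite (Prop_irrelevance h h'). Qed.

Section Object.
Variable F : qcohSheaf X.

Definition ind_qcoh : qcohSheaf X := product (fun g => pull s g F).

(** The components at provably equal g and h have different types; they can only
    be compared after restriction to a common open subset. *)
Lemma mres_idx U V (x : ind_qcoh U) g h (hg : V `<=` translate s g U)
    (hh : V `<=` translate s h U) :
  g = h -> mres F hg (x g : F (translate s g U)) = mres F hh (x h).
Proof. by move=> e; subst h; rewrite (Prop_irrelevance hg hh). Qed.

Lemma ind_addE U (x y : ind_qcoh U) g :
  (x + y) g = (x g : F (translate s g U)) + (y g : F (translate s g U)).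
Proof. by []. Qed.

Lemma ind_scaleE U (a : fn U) (x : ind_qcoh U) g :
  (a *: x) g = translate_fn s g a *: (x g : F (translate s g U)).
Proof. by []. Qed.

Lemma ind_sumE U (I : finType) (x : I -> ind_qcoh U) g :
  (\sum_i x i) g = \sum_i (x i g : F (translate s g U)).
Proof.
exact: (big_morph (fun y : ind_qcoh U => y g : F (translate s g U))
  (fun y z => ind_addE y z g) erefl).
Qed.

(** At h, a section of Ind F over gU has a component over h(gU) = (hg)U: this is
    why indices are multiplied by g on the right. *)
Definition ind_lin g (Hg : g \in G) U (x : ind_qcoh U) :
    ind_qcoh (translate s g U) :=
  fun h => mres F (@sub_translateM _ _ _ s h g U) (x (h * g)%g : F _).

Definition ind_sheaf : eqSheaf s G.
Proof.
refine (@EqSheaf _ _ _ _ G ind_qcoh ind_lin _ _ _ _ _).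
- move=> g Hg U x y; apply: dfunP => h.
  exact: (@mresD X F _ _ _ (x (h * g)%g) (y (h * g)%g)).
- move=> g Hg U a x; apply: dfunP => h.
  rewrite [LHS](@mresZ X F _ _ _ _ (x (h * g)%g)).
  by rewrite (translate_fnM _ (@subset_refl _ _)) fres_id.
- move=> g Hg U V VU gVU x; apply: dfunP => h.
  by rewrite /ind_lin /= /prod_res /= /pull_res !mres_trans; apply: mres_irr.
- move=> H1 U V e e' x; apply: dfunP => h.
  rewrite /= /prod_res /= /pull_res /ind_lin mres_trans.
  by apply: mres_idx; rewrite mulg1.
- move=> g h Hg Hh Hgh U V e e' x; apply: dfunP => f.
  rewrite /= /prod_res /= /pull_res /ind_lin !mres_trans.
  by apply: mres_idx; rewrite mulgA.
Defined.

End Object.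

(** The isomorphism lambda_1 is the restriction along 1U = U, with which all
    morphisms of sheaves commute. *)
Lemma trivial_lin (F F' : eqSheaf s 1%G) (f : forall U, F U -> F' U) :
  (forall U V (h : V `<=` U) (x : F U), f V (mres F h x) = mres F' h (f U x)) ->
  forall g (Hg : g \in 1%G) U (x : F U), f _ (lin F Hg x) = lin F' Hg (f U x).
Proof.
move=> fres g Hg; have g1 : g = 1%g by apply/set1gP.
subst g => U x.
have linE (E : eqSheaf s 1%G) (y : E U) : lin E Hg y = mres E (@translate1_sub _ _ _ s U) y.
  by rewrite -(lin1 Hg (@subset_refl _ _)) mres_id.
by rewrite !linE fres.
Qed.

Definition triv_mor (F F' : eqSheaf s 1%G) (f : forall U, F U -> F' U)
    (fD : forall U (x y : F U), f U (x + y) = f U x + f U y)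
    (fZ : forall U (a : fn U) (x : F U), f U (a *: x) = a *: f U x)
    (fR : forall U V (h : V `<=` U) (x : F U),
       f V (mres F h x) = mres F' h (f U x)) : eqMor F F' :=
  EqMor fD fZ fR (trivial_lin fR).

Definition ind_mor (F F' : eqSheaf s 1%G) (f : eqMor F F') :
  eqMor (ind_sheaf F) (ind_sheaf F').
Proof.
refine (@EqMor _ _ _ _ _ (ind_sheaf F) (ind_sheaf F')
  (fun U x g => f (translate s g U) (x g)) _ _ _ _).
- by move=> U x y; apply: dfunP => g; apply: morD.
- by move=> U a x; apply: dfunP => g; apply: morZ.
- by move=> U V h x; apply: dfunP => g; apply: mor_res.
- by move=> g Hg U x; apply: dfunP => h; apply: mor_res.
Defined.

Definition Ind : functor (Qcoh s 1%G) (Qcoh s G).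
Proof.
refine (@Functor (Qcoh s 1%G) (Qcoh s G) (fun F => ind_sheaf (F : eqSheaf s 1%G)) ind_mor _ _ _ _).
- by move=> F F' f g e U x; apply: dfunP => h; apply: e.
- by [].
- by [].
- by [].
Defined.

Definition Res : functor (Qcoh s G) (Qcoh s 1%G) := restriction s (sub1G G).

Lemma mor0 H (F F' : eqSheaf s H) (f : eqMor F F') U : f U 0 = 0.
Proof. by rewrite -(scale0r (0 : F U)) morZ scale0r. Qed.

Lemma mor_sum H (F F' : eqSheaf s H) (f : eqMor F F') U (I : finType) (x : I -> F U) :
  f U (\sum_i x i) = \sum_i f U (x i).
Proof. by apply: (big_morph (f U)) => [y z|]; rewrite ?morD ?mor0. Qed.

Lemma lin_lin (N : eqSheaf s G) g h p (Hg : g \in G) (Hh : h \in G) (Hp : p \in G)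
    U V (e : V `<=` translate s g (translate s h U)) (e' : V `<=` translate s p U)
    (x : N U) :
  (g * h)%g = p -> mres N e (lin N Hg (lin N Hh x)) = mres N e' (lin N Hp x).
Proof. by move=> gh; subst p; rewrite (linM Hg Hh Hp e'). Qed.

Lemma lin_id (N : eqSheaf s G) g (Hg : g \in G) U V (e : V `<=` translate s g U)
    (e' : V `<=` U) (x : N U) : g = 1%g -> mres N e (lin N Hg x) = mres N e' x.
Proof. by move=> g1; subst g; apply: lin1. Qed.

Lemma lin_linV (N : eqSheaf s G) g h (Hg : g \in G) (Hh : h \in G)
    U V (e : V `<=` translate s g (translate s h U)) (e' : V `<=` U)
    (x : N U) :
  (g * h = 1)%g -> mres N e (lin N Hg (lin N Hh x)) = mres N e' x.
Proof.
move=> gh; have e1 : V `<=` translate s (g * h)%g U by rewrite translateM.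
by rewrite (lin_lin Hg Hh (in_full _) e e1 x erefl) (lin_id _ _ e').
Qed.

(** * Induction is right adjoint to restriction *)

Definition coind_unit (N : eqSheaf s G) : eqMor N (Ind (Res N) : eqSheaf s G).
Proof.
refine (@EqMor _ _ _ _ _ N (ind_sheaf (res_sheaf (sub1G G) N))
  (fun U x g => lin N (in_full g) x) _ _ _ _).
- by move=> U x y; apply: dfunP => g; exact: (linD (in_full g) x y).
- by move=> U a x; apply: dfunP => g; exact: (linZ (in_full g) a x).
- by move=> U V h x; apply: dfunP => g; exact: (lin_res (in_full g) h).
- move=> g Hg U x; apply: dfunP => h.
  rewrite /= /ind_lin /= (linM (in_full h) Hg (in_full (h * g)) _ (@subset_refl _ _)).
  by rewrite mres_id.
Defined.

Definition coind_counit (F : eqSheaf s 1%G) : eqMor (Res (Ind F) : eqSheaf s 1%G) F.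
Proof.
refine (@triv_mor (res_sheaf (sub1G G) (ind_sheaf F)) F
  (fun U x => mres F (@sub_translate1 _ _ _ s U) (x 1%g : F _)) _ _ _).
- by move=> U x y; apply: (@mresD X F _ _ _ (x 1%g) (y 1%g)).
- move=> U a x; rewrite [LHS](@mresZ X F _ _ _ _ (x 1%g)).
  by rewrite (translate_fn1 _ (@subset_refl _ U)) fres_id.
- move=> U V h x; rewrite /= /prod_res /= /pull_res.
  by rewrite !mres_trans; apply: mres_irr.
Defined.

Definition Res_Ind_adjunction : adjunction Res Ind.
Proof.
refine (@Adjunction (Qcoh s 1%G) (Qcoh s G) Res Ind coind_unit coind_counit _ _ _ _).
- by move=> N N' f U x /=; apply: dfunP => g; rewrite /app /= mor_lin.
- by move=> F F' f U x /=; rewrite mor_res.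
- move=> N U x /=.
  rewrite [LHS](@lin_id N 1%g (in_full 1) U U _ (@subset_refl _ U) x erefl).
  exact: mres_id.
- move=> F U x /=; apply: dfunP => g; rewrite /ind_lin /= mres_trans.
  have /= -> := @mres_idx F U _ x _ g _ (@subset_refl _ _) (mul1g g).
  exact: mres_id.
Defined.

(** * Induction is left adjoint to restriction *)

Lemma lin_idx (N : eqSheaf s G) U V (x : forall g, N (translate s g U)) f
    (Hf : f \in G) p q (e : V `<=` translate s f (translate s p U))
    (e' : V `<=` translate s f (translate s q U)) :
  p = q -> mres N e (lin N Hf (x p)) = mres N e' (lin N Hf (x q)).
Proof. by move=> pq; subst p; apply: mres_irr. Qed.

Lemma sub1_translate g U : g = 1%g -> translate s g U `<=` U.
Proof. by move->; rewrite translate1. Qed.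

(** The component x_g, a section over gU, is brought back to U by the inverse of
    lambda_g before summing. *)
Definition ind_counit (N : eqSheaf s G) : eqMor (Ind (Res N) : eqSheaf s G) N.
Proof.
refine (@EqMor _ _ _ _ _ (ind_sheaf (res_sheaf (sub1G G) N)) N
  (fun U x => \sum_g mres N (@sub_translateVK _ _ _ s g U)
                 (lin N (in_full g^-1) (x g : N _))) _ _ _ _).
- move=> U x y; rewrite -big_split; apply: eq_bigr => g _ /=.
  by rewrite [lin N _ _](linD (in_full g^-1) (x g : N _) (y g : N _)) mresD.
- move=> U a x; rewrite scaler_sumr; apply: eq_bigr => g _ /=.
  rewrite [lin N _ _](linZ (in_full g^-1) (translate_fn s g a) (x g : N _)) mresZ.
  by rewrite (translate_fnVM (mulVg g) _ (@subset_refl _ U)) fres_id.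
- move=> U V h x; rewrite mres_sum; apply: eq_bigr => g _ /=.
  rewrite [lin N _ _](lin_res (in_full g^-1) (translateS h)
    (translateS (translateS h)) (x g : N _)).
  by rewrite !mres_trans; apply: mres_irr.
- move=> h Hh U x; rewrite lin_sum.
  rewrite (reindex_inj (mulIg h^-1)%g) /=; apply: eq_bigr => g _.
  rewrite (lin_res Hh (@sub_translateVK _ _ _ s g U) (translateS (@sub_translateVK _ _ _ s g U))).
  rewrite /ind_lin /=.
  have -> := lin_res (in_full (g * h^-1)^-1) (@sub_translateM _ _ _ s (g * h^-1) h U)
    (translateS (@sub_translateM _ _ _ s (g * h^-1) h U)) (x (g * h^-1 * h)%g : N _).
  rewrite mres_trans.
  have e : translate s h U `<=` translate s (g * h^-1)^-1 (translate s g U).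
    by rewrite -translateM invMg invgK mulgKV.
  rewrite (@lin_idx N U _ x _ _ _ _ _ e (mulgKV h g)).
  by rewrite (lin_lin _ _ (in_full (g * h^-1)^-1) _ e) // invMg invgK.
Defined.

(** The section x, placed in the component at 1.  The test g = 1 has to return a
    proof, as it is used to restrict x from U to gU. *)
Definition ind_unit_fun (F : eqSheaf s 1%G) U (x : F U) g : F (translate s g U) :=
  match @eqP _ g 1%g with
  | ReflectT g1 => mres F (@sub1_translate g U g1) x
  | ReflectF _ => 0
  end.

Lemma ind_unit_fun1 (F : eqSheaf s 1%G) U V (x : F U) g (h : V `<=` translate s g U)
    (h' : V `<=` U) : g = 1%g -> mres F h (ind_unit_fun x g) = mres F h' x.
Proof.
rewrite /ind_unit_fun; case: eqP => // g1 _.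
by rewrite mres_trans; apply: mres_irr.
Qed.

Lemma ind_unit_fun0 (F : eqSheaf s 1%G) U (x : F U) g :
  g != 1%g -> ind_unit_fun x g = 0.
Proof. by rewrite /ind_unit_fun; case: eqP. Qed.

Definition ind_unit (F : eqSheaf s 1%G) : eqMor F (Res (Ind F) : eqSheaf s 1%G).
Proof.
refine (@triv_mor F (res_sheaf (sub1G G) (ind_sheaf F)) (fun U x => ind_unit_fun x) _ _ _).
- move=> U x y; apply: dfunP => g; rewrite [RHS]ind_addE /=.
  rewrite /ind_unit_fun; case: eqP => g1; [exact: mresD | by rewrite addr0].
- move=> U a x; apply: dfunP => g; rewrite [RHS]ind_scaleE.
  rewrite /ind_unit_fun; case: eqP => g1; last by rewrite scaler0.
  rewrite mresZ; suff -> : fres (sub1_translate g1) a = translate_fn s g a by [].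
  subst g; by rewrite -(translate_fn1 (@subset_refl _ _)) fres_id.
- move=> U V h x; apply: dfunP => g.
  rewrite /= /prod_res /= /pull_res /ind_unit_fun; case: eqP => g1; last by rewrite mres0.
  by rewrite !mres_trans; apply: mres_irr.
Defined.

Definition Ind_Res_adjunction : adjunction Ind Res.
Proof.
refine (@Adjunction (Qcoh s G) (Qcoh s 1%G) Ind Res ind_unit ind_counit _ _ _ _).
- move=> F F' f U x; apply: dfunP => g /=.
  rewrite /ind_unit_fun; case: eqP => g1; [by rewrite mor_res | by rewrite mor0].
- move=> N N' f U x /=; rewrite mor_sum; apply: eq_bigr => g _.
  by rewrite mor_res mor_lin.
- (* Only the summand g = h contributes to the component at h. *)
  move=> F U x /=; apply: dfunP => h.
  rewrite [LHS]ind_sumE (bigD1 h) //= big1 => [|g gh]; last first.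
    rewrite /prod_res /= /pull_res /ind_lin ind_unit_fun0 ?mres0 //.
    by rewrite -eq_mulgV1 eq_sym.
  rewrite addr0 /prod_res /= /pull_res /ind_lin mres_trans.
  by rewrite (ind_unit_fun1 _ _ (@subset_refl _ _) (mulgV h)) mres_id.
- move=> N U y /=; rewrite (bigD1 1%g) //= big1 => [|g g1]; last first.
    by rewrite ind_unit_fun0 // lin0 mres0.
  rewrite addr0.
  have -> := lin_id (in_full 1^-1) _ (@sub_translate1 _ _ _ s U)
    (ind_unit_fun (y : res_sheaf (sub1G G) N U) 1%g : N _) (invg1 gT).
  have -> := @ind_unit_fun1 (res_sheaf (sub1G G) N) U U y 1%g
    (@sub_translate1 _ _ _ s U) (@subset_refl _ U) erefl.
  exact: mres_id.
Defined.

(** * Tensoring with the regular representation *)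

Lemma regular_repr_entry (g h : gT) (i : 'I_#|G|) :
  regular_repr k G g i (gring_index G h) = (i == gring_index G (h * g^-1)%g)%:R.
Proof.
rewrite !mxE eqxx /=; congr ((nat_of_bool _)%:R).
rewrite -2!(inj_eq (can_inj (gring_valK (G := G)))) !gring_indexK ?in_full //.
by rewrite eq_sym (can2_eq (mulgK g) (mulgKV g)).
Qed.

Notation tens := (tensor_sheaf (regular_repr k G)).

(** In F (x) k[G] the group acts on the components through lambda and permutes
    them.  Applying lambda_g to the component at g absorbs the first action, and
    only the permutation remains, as in Ind. *)
Definition tens_to (N : eqSheaf s G) : eqMor (tens N) (Ind (Res N) : eqSheaf s G).
Proof.
refine (@EqMor _ _ _ _ _ (tens N) (ind_sheaf (res_sheaf (sub1G G) N))
  (fun U x g => lin N (in_full g) (x (gring_index G g) : N U)) _ _ _ _).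
- by move=> U x y; apply: dfunP => g; rewrite ffunE linD.
- by move=> U a x; apply: dfunP => g; rewrite ffunE linZ.
- by move=> U V h x; apply: dfunP => g; rewrite ffunE; exact: (lin_res (in_full g) h).
- move=> g Hg U x; apply: dfunP => h; rewrite ffunE /= /ind_lin /=.
  rewrite (bigD1 (gring_index G (h * g)%g)) //= big1 => [|i ih]; last first.
    by rewrite regular_repr_entry invgK (negPf ih) scal0 scale0r.
  rewrite regular_repr_entry invgK eqxx scal1 scale1r addr0.
  by rewrite (linM (in_full h) Hg (in_full (h * g)) _ (@subset_refl _ _)) mres_id.
Defined.

Definition tens_from_fun (N : eqSheaf s G) U (y : Ind (Res N) U) : tens N U :=
  [ffun i : 'I_#|G| => mres N (@sub_translateVK _ _ _ s (enum_val i) U)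
    (lin N (in_full (enum_val i)^-1) (y (enum_val i) : N _))].

Lemma tens_toK (N : eqSheaf s G) U (x : tens N U) :
  tens_from_fun (mor (tens_to N) U x) = x.
Proof.
apply/ffunP => i; rewrite ffunE /= gring_valK.
by rewrite (lin_linV _ _ _ (@subset_refl _ U)) ?mulVg ?mres_id.
Qed.

Lemma tens_fromK (N : eqSheaf s G) U (y : ind_sheaf (res_sheaf (sub1G G) N) U) :
  mor (tens_to N) U (tens_from_fun y) = y.
Proof.
apply: dfunP => g; rewrite /= ffunE.
have gE : enum_val (gring_index G g) = g by rewrite gring_indexK ?in_full.
move: (enum_val _) gE => p pg.
have e : translate s g U `<=` translate s p U by rewrite pg.
have -> := lin_res (in_full g) (@sub_translateVK _ _ _ s p U)
  (translateS (@sub_translateVK _ _ _ s p U)) (lin N (in_full p^-1) (y p : N _)).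
rewrite (lin_linV _ _ _ e); last by rewrite pg mulgV.
have /= -> := @mres_idx N U _ y _ _ e (@subset_refl _ _) pg.
exact: mres_id.
Qed.

Lemma eqMor_inverse H (F F' : eqSheaf s H) (f : eqMor F F') (f' : forall U, F' U -> F U) :
  (forall U x, f' U (f U x) = x) -> (forall U y, f U (f' U y) = y) ->
  exists g : eqMor F' F, forall U y, g U y = f' U y.
Proof.
move=> fK f'K; have finj U := can_inj (fK U).
unshelve eexists (@EqMor _ _ _ _ _ F' F f' _ _ _ _) => //.
- by move=> U x y; apply: finj; rewrite morD !f'K.
- by move=> U a x; apply: finj; rewrite morZ !f'K.
- by move=> U V h x; apply: finj; rewrite mor_res !f'K.
- by move=> g Hg U x; apply: finj; rewrite mor_lin !f'K.
Qed.

Definition tens_from (N : eqSheaf s G) : eqMor (Ind (Res N) : eqSheaf s G) (tens N) :=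
  projT1 (cid (eqMor_inverse (@tens_toK N) (@tens_fromK N))).

Lemma tens_fromE (N : eqSheaf s G) U y : tens_from N U y = tens_from_fun y.
Proof. exact: (projT2 (cid (eqMor_inverse (@tens_toK N) (@tens_fromK N)))). Qed.

Definition Tens : functor (Qcoh s G) (Qcoh s G) := tensor_functor s (regular_repr k G).

Lemma tens_to_natural : natural (F := Tens) (G := functor_comp Ind Res) tens_to.
Proof.
by move=> N N' f U x; apply: dfunP => g; rewrite /= ffunE mor_lin.
Qed.

Lemma tens_from_natural : natural (F := functor_comp Ind Res) (G := Tens) tens_from.
Proof.
move=> N N' f U y.
apply: (can_inj (@tens_toK N' U)); rewrite /= !tens_fromE.
have e : tens_to N' U (tensor_mor (regular_repr k G) f U (tens_from_fun y))
    = (fun g => (f : eqMor N N') _ (mor (tens_to N) U (tens_from_fun y) g)).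
  exact: (tens_to_natural f (tens_from_fun y)).
by rewrite tens_fromK in e; apply: etrans (esym e); apply: tens_fromK.
Qed.

(** Forgetting the linearization of F (x) k[G] leaves a sum of copies of F: the
    permutation of the components disappears. *)
Definition tens_proj (i : 'I_#|G|) (N : eqSheaf s G) :
  eqMor (Res (Tens N) : eqSheaf s 1%G) (Res N : eqSheaf s 1%G).
Proof.
refine (@triv_mor (res_sheaf (sub1G G) (tens N)) (res_sheaf (sub1G G) N)
  (fun U x => (x : tens N U) i) _ _ _) => *; exact: ffunE.
Defined.

Definition tens_inj (i : 'I_#|G|) (N : eqSheaf s G) :
  eqMor (Res N : eqSheaf s 1%G) (Res (Tens N) : eqSheaf s 1%G).
Proof.
refine (@triv_mor (res_sheaf (sub1G G) N) (res_sheaf (sub1G G) (tens N))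
  (fun U x => [ffun j : 'I_#|G| => if j == i then x else 0] : tens N U) _ _ _).
- by move=> U x y; apply/ffunP => j; rewrite !ffunE; case: eqP; rewrite ?addr0.
- by move=> U a x; apply/ffunP => j; rewrite !ffunE; case: eqP; rewrite ?scaler0.
- move=> U V h x; apply/ffunP => j; rewrite !ffunE; case: eqP => // _.
  by rewrite [RHS](@mres0 _ _ _ s G N).
Defined.

Lemma tens_proj_natural i :
  natural (F := functor_comp Res Tens) (G := Res) (tens_proj i).
Proof. by move=> N N' f U x; rewrite /= /app /= ffunE. Qed.

Lemma tens_inj_natural i :
  natural (F := Res) (G := functor_comp Res Tens) (tens_inj i).
Proof.
move=> N N' f U x; apply/ffunP => j; rewrite !ffunE; case: eqP => // _.
by rewrite mor0.
Qed.

Lemma app_hsum H (F F' : Qcoh s H) (I : Type) (r : seq I) (f : I -> hom F F')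
    U (x : (F : eqSheaf s H) U) : app (hsum r f) x = \sum_(i <- r) app (f i) x.
Proof.
by elim: r => [|i r IH]; rewrite ?big_nil // big_cons -IH.
Qed.

Lemma tens_decomp (N : Qcoh s G) :
  hsum (enum 'I_#|G|) (fun i => (tens_inj i N : @hom (Qcoh s 1%G) _ _) \oh
     (tens_proj i N : @hom (Qcoh s 1%G) _ _)) ==h hid (Res (Tens N)).
Proof.
move=> U x; apply: etrans (app_hsum _ _ _) _.
rewrite big_enum; apply/ffunP => j; rewrite sum_ffunE (bigD1 j) //=.
rewrite big1 => [|i ij]; first by rewrite addr0 ffunE eqxx.
by rewrite ffunE eq_sym (negPf ij).
Qed.

End Induction.

(** * Quasi-isomorphisms *)

Section Derived.
Variables (k : fieldType) (X : scheme k) (gT : finGroupType) (s : gaction X gT).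
Implicit Types (U V W : opens X) (g h : gT).

Let G : {group gT} := [set: gT]%G.

Lemma common_translate U (V : gT -> opens X) (p : X) :
  oset U p -> (forall g, oset (V g) (s g p)) ->
  exists W : opens X, [/\ oset W p, W `<=` U & forall g, translate s g W `<=` V g].
Proof.
move=> Up Vp.
have oW : open [set q | oset U q /\ forall g, oset (V g) (s g q)].
  rewrite openE => q [Uq Vq]; apply: filterI.
    exact: (open_nbhs_nbhs (conj (osetP U) Uq)).
  apply: filter_forall => g.
  exact: (open_nbhs_nbhs (conj (osetP (preim (scont (s g)) (V g))) (Vq g))).
exists (Opens oW); split=> // [q []//|g q /= [_ /(_ g)]].
by rewrite actKV.
Qed.

Lemma Res_quasi_iso (K L : Ch (Qcoh s G)) (f : @hom (Ch (Qcoh s G)) K L) :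
  quasi_iso f -> quasi_iso (fmap (ch_functor (Res s)) f).
Proof. by []. Qed.

Lemma Ind_cocycle (K : complex (Qcoh s 1%G)) n U
    (x : (complex_map (Ind s) K n : eqSheaf s G) U) :
  cocycle x <-> forall g, @cocycle _ _ _ _ _ K n (translate s g U) (x g).
Proof.
split=> [x0 g|x0]; first exact: (congr1 (@^~ g) x0).
by apply: dfunP => g; apply: x0.
Qed.

(** A point has finitely many translates, so that neighbourhoods of all of them
    contain the translates of a single one; hence being a boundary near the
    point is a condition on each component separately. *)
Lemma Ind_local_boundary (K : complex (Qcoh s 1%G)) n U
    (x : (complex_map (Ind s) K n : eqSheaf s G) U) :
  local_boundary x <->
  forall g, @local_boundary _ _ _ _ _ K n (translate s g U) (x g).
Proof.
split=> [xb g q Uq|xb p Up].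
  have [V [h [u [Vq uP]]]] := xb _ Uq.
  exists (translate s g V), (translateS h), (u g); split=> //.
  exact: (congr1 (@^~ g) uP).
have gp g : oset (translate s g U) (s g p) by rewrite /translate /= actVK.
have /dfun_choice [V /dfun_choice [h /dfun_choice [u uP]]] := fun g => xb g _ (gp g).
have [W [Wp WU WV]] := common_translate Up (fun g => (uP g).1).
exists W, WU, (fun g => mres (K (n - 1) : eqSheaf s 1%G) (WV g) (u g)); split=> //.
apply: dfunP => g; apply: etrans (mor_res _ (WV g) (u g)) _.
rewrite -/(app _ _) (uP g).2 mres_trans.
exact: mres_irr.
Qed.

Lemma Ind_quasi_iso (K L : Ch (Qcoh s 1%G)) (f : @hom (Ch (Qcoh s 1%G)) K L) :
  quasi_iso f -> quasi_iso (fmap (ch_functor (Ind s)) f).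
Proof.
move=> qf n; have [inj surj] := qf n; split=> [U x|U y /Ind_cocycle y0 p Up].
  move=> /Ind_cocycle x0 /Ind_local_boundary fxb.
  by apply/Ind_local_boundary => g; apply: inj (x0 g) (fxb g).
have gp g : oset (translate s g U) (s g p) by rewrite /translate /= actVK.
have /dfun_choice [V /dfun_choice [h /dfun_choice [x /dfun_choice [u uP]]]] :=
  fun g => surj _ _ (y0 g) _ (gp g).
have Vp g : oset (V g) (s g p) by case: (uP g).
have [W [Wp WU WV]] := common_translate Up Vp.
exists W, WU, (fun g => mres ((K : complex _) n : eqSheaf s 1%G) (WV g) (x g)),
  (fun g => mres ((L : complex _) (n - 1) : eqSheaf s 1%G) (WV g) (u g)).
split=> //.
  apply/Ind_cocycle => g; case: (uP g) => _ xg0 _.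
  apply: etrans (mor_res _ (WV g) (x g)) _.
  by rewrite -/(app _ _) xg0 mres0.
apply: dfunP => g; case: (uP g) => _ _ e.
have := congr1 (mres ((L : complex _) n : eqSheaf s 1%G) (WV g)) e.
rewrite mres_trans mresD /app -!mor_res => e'.
by apply: etrans e'; apply: mres_irr.
Qed.

(** * Adjunctions between the derived categories *)

Definition DRes : functor (Dqcoh s G) (Dqcoh s 1%G) := localized Res_quasi_iso.

Definition DInd : functor (Dqcoh s 1%G) (Dqcoh s G) := localized Ind_quasi_iso.

Definition DInd_DRes_adjunction : adjunction DInd DRes :=
  localized_adjunction (ch_adjunction (Ind_Res_adjunction s))
    Ind_quasi_iso Res_quasi_iso.

Definition DRes_DInd_adjunction : adjunction DRes DInd :=
  localized_adjunction (ch_adjunction (Res_Ind_adjunction s))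
    Res_quasi_iso Ind_quasi_iso.

Section TensorComplex.
Variable T : complex (Qcoh s G).

Let P : complex (Qcoh s G) := complex_map (Tens s) T.

Definition ch_tens_to : chainMap P (complex_map (Ind s) (complex_map (Res s) T)).
Proof.
refine (@ChainMap _ P (complex_map (Ind s) (complex_map (Res s) T))
  (fun n => tens_to (T n)) _) => m n.
by apply: heq_sym; apply: tens_to_natural.
Defined.

Definition ch_tens_from : chainMap (complex_map (Ind s) (complex_map (Res s) T)) P.
Proof.
refine (@ChainMap _ (complex_map (Ind s) (complex_map (Res s) T)) P
  (fun n => tens_from (T n)) _) => m n.
by apply: heq_sym; apply: tens_from_natural.
Defined.

Lemma tens_universal : exists u : @hom (Dqcoh s 1%G) (DRes T) (DRes P),
  universal_arrow u.
Proof.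
eexists; apply: (adjunction_universal DInd_DRes_adjunction
  (phi := fmap (loc_functor _) (ch_tens_to : @hom (Ch (Qcoh s G)) _ _))
  (psi := fmap (loc_functor _) (ch_tens_from : @hom (Ch (Qcoh s G)) _ _))).
- apply: leTrans (leSym (leOfComp _ _ _)) _; apply: leOf => n U x.
  by rewrite /= tens_fromE tens_toK.
- apply: leTrans (leSym (leOfComp _ _ _)) _; apply: leOf => n U x.
  by rewrite -[RHS](tens_fromK x) -tens_fromE.
Qed.

Variable i : int.

Definition shift_tens_proj (j : 'I_#|G|) :
  chainMap (complex_map (Res s) (shift i P)) (shift i (complex_map (Res s) T)).
Proof.
refine (@ChainMap _ (complex_map (Res s) (shift i P)) (shift i (complex_map (Res s) T))
  (fun n => tens_proj j (T (n + i))) _) => m n.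
apply: heq_trans (hcomp_hsignl _ _ _) _; apply: heq_sym.
apply: heq_trans (hcomp_eq (heq_refl _) (fmap_hsign _ _ _)) _.
apply: heq_trans (hcomp_hsignr _ _ _) _.
by apply: hsign_proper; apply: tens_proj_natural.
Defined.

Definition shift_tens_inj (j : 'I_#|G|) :
  chainMap (shift i (complex_map (Res s) T)) (complex_map (Res s) (shift i P)).
Proof.
refine (@ChainMap _ (shift i (complex_map (Res s) T)) (complex_map (Res s) (shift i P))
  (fun n => tens_inj j (T (n + i))) _) => m n.
apply: heq_sym.
apply: heq_trans (hcomp_hsignr _ _ _) _; apply: heq_sym.
apply: heq_trans (hcomp_eq (fmap_hsign _ _ _) (heq_refl _)) _.
apply: heq_trans (hcomp_hsignl _ _ _) _; apply: heq_sym.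
by apply: hsign_proper; apply: tens_inj_natural.
Defined.

(** The identity of Res (P[i]) is the sum of the composites through the copies of
    (Res T)[i], and all morphisms from Res T to these vanish. *)
Lemma shift_tens_eq0 (v : @hom (Dqcoh s 1%G) (DRes T) (DRes (shift i P))) :
  (forall w : @hom (Dqcoh s 1%G) (DRes T) (shift i (DRes T)),
     w ==h hzero (DRes T) (shift i (DRes T) : Dqcoh s 1%G)) ->
  v ==h hzero _ _.
Proof.
move=> T0.
pose Q := loc_functor (@quasi_iso _ _ _ s 1%G).
pose p j := fmap Q (shift_tens_proj j : @hom (Ch (Qcoh s 1%G)) _ _).
pose q j := fmap Q (shift_tens_inj j : @hom (Ch (Qcoh s 1%G)) _ _).
have e : hsum (enum 'I_#|G|) (fun j => q j \oh p j) ==h hid (DRes (shift i P)).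
  apply: heq_trans (eq_hsum _ (fun j => heq_sym (fmapM Q _ _))) _.
  apply: heq_trans (heq_sym (fmap_sum Q _ _)) _.
  apply: heq_trans _ (fmap1 Q _); apply: fmap_eq => n.
  apply: heq_trans (hsum_ch _ _ _) _; exact: tens_decomp.
apply: heq_trans (heq_sym (hcomp1l v)) _.
apply: heq_trans (hcomp_eq (heq_sym e) (heq_refl _)) _.
apply: heq_trans (hcomp_suml _ _ _) _; apply: hsum0 => j.
apply: heq_trans (heq_sym (hcompA _ _ _)) _.
apply: heq_trans (hcomp_eq (heq_refl _) (T0 (p j \oh v))) _.
exact: hcomp0r.
Qed.

End TensorComplex.

Section Scaling.
Variables (c : k) (N : complex (Qcoh s G)).

Definition scale_mor (F : eqSheaf s G) : eqMor F F.
Proof.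
refine (@EqMor _ _ _ _ _ F F (fun U x => scal U c *: x) _ _ _ _).
- by move=> U x y; rewrite scalerDr.
- by move=> U a x; rewrite !scalerA mulrC.
- by move=> U V h x; rewrite mresZ scal_res.
- by move=> g Hg U x; rewrite lin_scal.
Defined.

Definition ch_scale : chainMap N N.
Proof.
refine (@ChainMap _ N N (fun n => scale_mor (N n)) _) => m n U x /=.
exact: morZ.
Defined.

End Scaling.

(** Every summand lambda_g^-1 (lambda_g x) is x. *)
Lemma counit_unit_card (N : eqSheaf s G) U (x : N U) :
  ind_counit N U (coind_unit N U x) = #|G|%:R *: x.
Proof.
rewrite /= (eq_bigr (fun=> x)) => [|g _].
  by rewrite sumr_const scaler_nat cardsT.
by rewrite (lin_linV _ _ _ (@subset_refl _ U)) ?mulVg // mres_id.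
Qed.

(** The identity of N factors through Ind (Res N), by dividing the composite above
    by the order of G. *)
Lemma DRes_conservative (N : Dqcoh s G) :
  #|G|%:R != 0 :> k -> hid (DRes N) ==h hzero _ _ -> hid N ==h hzero N N.
Proof.
move=> G0 N0.
pose Q := loc_functor (@quasi_iso _ _ _ s G).
pose a := fmap Q (ch_scale (#|G|%:R^-1) N : @hom (Ch (Qcoh s G)) _ _).
pose ep := counit DInd_DRes_adjunction N.
pose et := unit DRes_DInd_adjunction N.
have e : (a \oh ep) \oh et ==h hid N.
  apply: heq_trans (heq_sym (hcompA _ _ _)) _.
  apply: leTrans (leComp (leRefl _) (leSym (leOfComp _ _ _))) _.
  apply: leTrans (leSym (leOfComp _ _ _)) _; apply: leOf => n U x.
  rewrite -[LHS]/(scal U (#|G|%:R^-1) *: (ind_counit (N n) U (coind_unit (N n) U x))).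
  rewrite counit_unit_card.
  have -> : #|G|%:R = scal U #|G|%:R :> fn U by rewrite /scal !rmorph_nat.
  by rewrite scalerA -scalM mulVf // scal1 scale1r.
have i0 : hid (DInd (DRes N)) ==h hzero _ _.
  apply: heq_trans (heq_sym (fmap1 DInd _)) _.
  by apply: heq_trans (fmap_eq DInd N0) _; apply: fmap0.
have aep : a \oh ep ==h hzero _ _.
  apply: heq_trans (heq_sym (hcomp1r (a \oh ep))) _.
  exact: heq_trans (hcomp_eq (heq_refl (a \oh ep)) i0) (hcomp0r _ _).
apply: heq_trans (heq_sym e) _.
exact: heq_trans (hcomp_eq aep (heq_refl et)) (hcomp0l _ _).
Qed.

End Derived.

Local Close Scope classical_set_scope.

Theorem theorem4p2 (k : fieldType) (X : scheme k) (gT : finGroupType)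
    (s : gaction X gT) (T : Dqcoh s [set: gT]%G) :
  smooth X -> projective X ->
  (forall p : nat, p \in [pchar k]%R -> ~~ (p %| #|[set: gT]|)%N) ->
  tilting (forget T) ->
  tilting (tensor (regular_repr k [set: gT]%G) T).
Proof.
move=> _ _ charG [T_ext T_gen T_sum].
have [u univ] := tens_universal T.
split=> [i i0 f|N N0|].
- apply: (universal_arrow_eq0 univ); apply: shift_tens_eq0 => w.
  exact: T_ext.
- apply: DRes_conservative.
    apply/negP => G0; have [p pk] := natf0_pchar (cardG_gt0 _) G0.
    by have /negP[] := charG p pk; rewrite (dvdn_pcharf pk); exact: G0.
  apply: T_gen => i f.
  (* f : Res T -> (Res N)[i] is composed with (Res N)[i] = Res (N[i]), in order to
     come from a morphism T (x) k[G] -> N[i]. *)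
  pose Q := loc_functor (@quasi_iso _ _ _ s 1%G).
  pose a := fmap Q (shift_to (Res s) i N : @hom (Ch (Qcoh s 1%G)) _ _).
  pose b := fmap Q (shift_from (Res s) i N : @hom (Ch (Qcoh s 1%G)) _ _).
  have ab : a \oh b ==h hid _.
    apply: heq_trans (heq_sym (fmapM Q _ _)) _.
    apply: heq_trans _ (fmap1 Q _); apply: fmap_eq; exact: shift_fromK.
  have [h [hP _]] := univ (shift i N : Dqcoh s [set: gT]%G) (b \oh f).
  have Rh0 := heq_trans (fmap_eq (DRes s) (N0 i h)) (fmap0 (DRes s) _ _).
  have bf0 := heq_trans (heq_sym hP)
    (heq_trans (hcomp_eq Rh0 (heq_refl u)) (hcomp0l _ u)).
  apply: heq_trans (heq_sym (hcomp1l f)) _.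
  apply: heq_trans (hcomp_eq (heq_sym ab) (heq_refl f)) _.
  apply: heq_trans (heq_sym (hcompA a b f)) _.
  exact: heq_trans (hcomp_eq (heq_refl a) bf0) (hcomp0r _ a).
- apply: (universal_arrow_commutes_with_sums univ _ T_sum) => I N S inj.
  exact: (left_adjoint_coproduct (DRes_DInd_adjunction s)).
Qed.
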